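(* Let $m\ge 1$ and let $(\pi_\rho,V_\rho)$ be an irreducible unitary representation of $U(m)$ with highest weight $\rho$. With the Clifford homomorphisms $p_{\pm i}$ on $V_\rho$, the conformal weights $w_{\pm i}$ associated to $\rho$, and the polynomials $K_n(-c)$, $K_n(-\tilde c)$ of the Casimir elements as in the context, one has on $V_\rho$, for all $q\in\mathbb{Z}_{\ge0}$ and $k,l\in\{1,\dots,m\}$, $$\sum_{1\le i\le m}(w_{+i}-m)^q\,p_{+i}(\epsilon_k)^{\ast}p_{+i}(\epsilon_l)=(-1)^q\sum_{1\le i\le m}\Big(\sum_{p=0}^q\pi_\rho(K_{q-p}(-c))\,w_{-i}^p\Big)p_{-i}(\bar\epsilon_l)^{\ast}p_{-i}(\bar\epsilon_k),$$ $$\sum_{1\le i\le m}(w_{-i}-m)^q\,p_{-i}(\bar\epsilon_k)^{\ast}p_{-i}(\bar\epsilon_l)=(-1)^q\sum_{1\le i\le m}\Big(\sum_{p=0}^q\pi_\rho(K_{q-p}(-\tilde c))\,w_{+i}^p\Big)p_{+i}(\epsilon_l)^{\ast}p_{+i}(\epsilon_k).$$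
   Context: Representations. Irreducible unitary representations $(\pi_\rho,V_\rho)$ of $U(m)$ are labelled by their highest weights $\rho=(\rho^1,\dots,\rho^m)\in\mathbb{Z}^m$ with $\rho^1\ge\cdots\ge\rho^m$ (''dominant integral''); weights are the simultaneous eigenvalues of $e_{11},\dots,e_{mm}$, where $e_{kl}$ is the $m\times m$ matrix with $1$ in place $(k,l)$ and $0$ elsewhere. $\pi_\rho$ also denotes the induced complex representation of $\mathfrak{gl}(m,\mathbb{C})=\mathfrak{u}(m)\otimes\mathbb{C}$ and of its universal enveloping algebra. $\mathbb{C}^m$ is the natural representation with standard unitary basis $\epsilon_1,\dots,\epsilon_m$, and $\overline{\mathbb{C}^m}$ its complex conjugate representation with basis $\bar\epsilon_1,\dots,\bar\epsilon_m$. Clifford homomorphisms. Let $\mu_i\in\mathbb{Z}^m$ be the $i$-th standard basis vector. One has multiplicity-free orthogonal decompositions $V_\rho\otimes\mathbb{C}^m=\bigoplus_{i=1}^m V_{\rho+\mu_i}$ and $V_\rho\otimes\overline{\mathbb{C}^m}=\bigoplus_{i=1}^m V_{\rho-\mu_i}$, where $V_{\rho\pm\mu_i}:=\{0\}$ if $\rho\pm\mu_i$ is not dominant integral. Let $\Pi_{\pm i}$ be the orthogonal projection onto $V_{\rho\pm\mu_i}$. For $u\in\mathbb{C}^m$, $\bar u\in\overline{\mathbb{C}^m}$, define $p_{+i}(u):V_\rho\to V_{\rho+\mu_i}$, $\phi\mapsto\Pi_{+i}(\phi\otimes u)$ and $p_{-i}(\bar u):V_\rho\to V_{\rho-\mu_i}$,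 $\phi\mapsto\Pi_{-i}(\phi\otimes\bar u)$; ${}^{\ast}$ denotes the adjoint. Conformal weights associated to $\rho$: $w_{+i}:=-\rho^i+i-1$ and $w_{-i}:=\rho^i+m-i$. Convention: $0^0=1$. Casimir elements. Put $c_0:=\tilde c_0:=m$ and for $q\ge1$ $$c_q:=\sum_{1\le k,i_1,\dots,i_{q-1}\le m}e_{ki_1}e_{i_1i_2}\cdots e_{i_{q-1}k},\qquad \tilde c_q:=(-1)^q\sum_{1\le k,i_1,\dots,i_{q-1}\le m}e_{i_1k}e_{i_2i_1}\cdots e_{ki_{q-1}}.$$ These are central in the enveloping algebra, hence act on $V_\rho$ as scalars. For $n\ge0$, $$K_n(-c):=\sum_{i_1+2i_2+\cdots+ni_n=n}\frac{(i_1+\cdots+i_n)!}{i_1!\cdots i_n!}\,c_0^{i_1}c_1^{i_2}\cdots c_{n-1}^{i_n}$$ (sum over non-negative integers, $K_0(-c)=1$), and $K_n(-\tilde c)$ is obtained by replacing each $c_j$ by $\tilde c_j$. *)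

(* Defs.v *)
From HB Require Import structures.
From mathcomp Require Import all_boot all_order all_algebra.
From mathcomp Require Import boolp classical_sets reals.
From mathcomp Require Import topology normedtype derive.
From mathcomp Require Import complex mxtens.

Set Implicit Arguments.
Unset Strict Implicit.
Unset Printing Implicit Defensive.

Import Order.TTheory GRing.Theory Num.Theory.
Import numFieldNormedType.Exports.

Local Open Scope ring_scope.
Local Open Scope complex_scope.
Local Open Scope sesquilinear_scope.

(* U(m) is the set of U : 'M[R[i]]_m with U \is unitarymx, and a representation
   of dimension N acts on column vectors, i.e. on C^N with its standard
   Hermitian inner product. Maps out of U(m) are total functions on matrices,
   whose values off U(m) are irrelevant. *)

Section Representations.
Context {R : realType} {m : nat}.
Local Notation C := R[i].

Definition is_unitary_rep (N : nat) (pi : 'M[C]_m -> 'M[C]_N) : Prop :=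
  [/\ forall U, U \is unitarymx -> pi U \is unitarymx,
      forall U V, U \is unitarymx -> V \is unitarymx ->
        pi (U *m V) = pi U *m pi V,
      pi 1%:M = 1%:M &
      forall U (e : R), U \is unitarymx -> 0 < e ->
        exists2 d : R, 0 < d & forall V, V \is unitarymx ->
          (forall i j, `|V i j - U i j| < d%:C) ->
          forall i j, `|pi V i j - pi U i j| < e%:C].

Definition has_velocity (N : nat) (g : R -> 'M[C]_N) (X : 'M[C]_N) : Prop :=
  forall i j,
    is_derive (0 : R) 1 (fun t => complex.Re (g t i j)) (complex.Re (X i j)) /\
    is_derive (0 : R) 1 (fun t => complex.Im (g t i j)) (complex.Im (X i j)).

Definition one_parameter_subgroup (g : R -> 'M[C]_m) : Prop :=
  (forall t, g t \is unitarymx) /\ (forall s t, g (s + t) = g s *m g t).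

(* The one-parameter subgroup with velocity X (in u(m)) is t |-> exp (t X), so
   this determines dpi on u(m), hence, being linear, on gl(m, C). *)
Definition is_induced_rep (N : nat) (pi : 'M[C]_m -> 'M[C]_N)
    (dpi : {linear 'M[C]_m -> 'M[C]_N}) : Prop :=
  forall (g : R -> 'M[C]_m) (X : 'M[C]_m),
    one_parameter_subgroup g -> has_velocity g X ->
    has_velocity (fun t => pi (g t)) (dpi X).

(* A matrix S stands for the subspace of column vectors v such that v^T lies
   in the row space of S; a matrix A maps that subspace into itself iff
   stablemx S A^T. *)
Definition stable_under (N p : nat) (pi : 'M[C]_m -> 'M[C]_N)
    (S : 'M[C]_(p, N)) : Prop :=
  forall U, U \is unitarymx -> stablemx S (pi U)^T.

Definition irreducible_subrep (N : nat) (pi : 'M[C]_m -> 'M[C]_N)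
    (S : 'M[C]_N) : Prop :=
  [/\ S != 0, stable_under pi S &
      forall T : 'M[C]_N, stable_under pi T -> (T <= S)%MS ->
        T = 0 \/ (S <= T)%MS].

Definition is_weight (N : nat) (dpi : 'M[C]_m -> 'M[C]_N) (S : 'M[C]_N)
    (lam : 'rV[int]_m) : Prop :=
  exists v : 'cV[C]_N, [/\ v != 0, (v^T <= S)%MS &
    forall k : 'I_m, dpi (delta_mx k k) *m v = (lam 0 k)%:~R *: v].

Definition lex_lt (lam mu : 'rV[int]_m) : Prop :=
  exists k : 'I_m,
    (forall j : 'I_m, (j < k)%N -> lam 0 j = mu 0 j) /\ lam 0 k < mu 0 k.

(* Weights are ordered lexicographically: the positive root vectors are the
   e_kl with k < l. *)
Definition is_highest_weight (N : nat) (dpi : 'M[C]_m -> 'M[C]_N)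
    (S : 'M[C]_N) (lam : 'rV[int]_m) : Prop :=
  is_weight dpi S lam /\
  forall mu, is_weight dpi S mu -> mu = lam \/ lex_lt mu lam.

Definition dominant (lam : 'rV[int]_m) : bool :=
  [forall i : 'I_m, forall j : 'I_m, (i <= j)%N ==> (lam 0 j <= lam 0 i)].

(* V_lam inside a multiplicity-free representation: its irreducible
   subrepresentation of highest weight lam, and 0 if lam is not dominant. *)
Definition constituent (N : nat) (pi dpi : 'M[C]_m -> 'M[C]_N)
    (lam : 'rV[int]_m) : 'M[C]_N :=
  if dominant lam then
    xget 0 [set S | irreducible_subrep pi S /\ is_highest_weight dpi S lam]%classic
  else 0.

(* Orthogonal projection as a matrix acting on column vectors; the transpose is
   there because proj_ortho acts on row vectors. *)
Definition col_proj (N : nat) (S : 'M[C]_N) : 'M[C]_N := (proj_ortho S)^T.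

End Representations.

(* C^m, its conjugate in the basis of the \bar epsilon_k (on which u(m) acts by
   conj X = - X^T, extended complex linearly to gl(m, C)), and tensor
   products with them. *)
Section TensorProducts.
Context {R : realType} {m n : nat}.
Local Notation C := R[i].
Variables (pi dpi : 'M[C]_m -> 'M[C]_n).

Definition tens_rep (U : 'M[C]_m) : 'M[C]_(n * m) := pi U *t U.
Definition tens_drep (X : 'M[C]_m) : 'M[C]_(n * m) :=
  dpi X *t 1%:M + 1%:M *t X.

Definition tensc_rep (U : 'M[C]_m) : 'M[C]_(n * m) := pi U *t map_mx Num.conj U.
Definition tensc_drep (X : 'M[C]_m) : 'M[C]_(n * m) :=
  dpi X *t 1%:M + 1%:M *t (- X^T).

(* The linear map phi |-> phi (x) u. *)
Definition tens_right (u : 'cV[C]_m) : 'M[C]_(n * m, n) :=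
  castmx (erefl, muln1 n) (1%:M *t u).

(* p_{+i}(u) and p_{-i}(ubar), with values seen in the whole tensor product;
   in clifford_minus, u holds the coordinates of ubar in the basis of the
   \bar epsilon_k, so that p_{-i}(\bar epsilon_k) is obtained at the k-th
   standard basis vector. *)
Definition clifford_plus (rho : 'rV[int]_m) (i : 'I_m) (u : 'cV[C]_m) :
    'M[C]_(n * m, n) :=
  col_proj (constituent tens_rep tens_drep (rho + delta_mx 0 i))
    *m tens_right u.

Definition clifford_minus (rho : 'rV[int]_m) (i : 'I_m) (u : 'cV[C]_m) :
    'M[C]_(n * m, n) :=
  col_proj (constituent tensc_rep tensc_drep (rho - delta_mx 0 i))
    *m tens_right u.

(* casimir q and casimirc q are the images of c_q and \tilde c_q in End V_rho.
   The summation index s is (k, i_1, ..., i_(q-1)), read cyclically. *)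
Definition casimir (q : nat) : 'M[C]_n :=
  if q is q'.+1 then
    \sum_(s : {ffun 'I_q'.+1 -> 'I_m})
      \prod_(j < q'.+1) dpi (delta_mx (s j) (s (ordS j)))
  else m%:R.

Definition casimirc (q : nat) : 'M[C]_n :=
  if q is q'.+1 then
    (-1) ^+ q *: \sum_(s : {ffun 'I_q'.+1 -> 'I_m})
      \prod_(j < q'.+1) dpi (delta_mx (s (ordS j)) (s j))
  else m%:R.

End TensorProducts.

(* K_N(-c) evaluated at a sequence c of matrices; f j is the exponent i_(j+1)
   of c_j, which never exceeds N. *)
Definition Kpoly {R : realType} {n : nat} (c : nat -> 'M[R[i]]_n) (N : nat) :
    'M[R[i]]_n :=
  \sum_(f : {ffun 'I_N -> 'I_N.+1} | (\sum_(j < N) j.+1 * f j == N)%N)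
    (((\sum_(j < N) f j)`!)%N%:R / (\prod_(j < N) (f j)`!)%N%:R : R[i])
      *: \prod_(j < N) c j ^+ f j.

(* The conformal weights, for i : 'I_m counted from 0. *)
Definition wplus {m : nat} (rho : 'rV[int]_m) (i : 'I_m) : int :=
  - rho 0 i + i%:Z.
Definition wminus {m : nat} (rho : 'rV[int]_m) (i : 'I_m) : int :=
  rho 0 i + m%:Z - i.+1%:Z.

(* Main.v *)
Require Import Defs.
From HB Require Import structures.
From mathcomp Require Import all_boot all_order all_algebra.
From mathcomp Require Import boolp classical_sets functions reals.
From mathcomp Require Import topology normedtype derive realfun trigo.
From mathcomp Require Import complex mxtens.
From mathcomp Require Import ring lra zify.

Set Implicit Arguments.
Unset Strict Implicit.
Unset Printing Implicit Defensive.

(** In [V (x) C^m] the operator [B = sum_(a,b) E_ab (x) e_ba] acts on the constituent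
    of highest weight [rho + mu_i] by the scalar [- w_{+i}]; in the tensor product with
    the conjugate of [C^m], the analogous operator [B'] built from [- E_ba] acts on the
    constituent of highest weight [rho - mu_i] by [- w_{-i}].  As the constituents
    exhaust the tensor products, both sides become matrix entries of polynomials in
    [B] and [B'].  Writing [A] for the matrix with entries [E_kl], the blocks of [B]
    are those of the transpose of [A] and the blocks of [- B'] are those of [A], so that
    the claim reduces to the identity
    [((A^T + m)^q)_kl = sum_p K_(q-p) (A^p)_lk], proved by induction on [q] from the
    commutation relations of [gl_m]; the second formula is the first one for the
    matrix with entries [- E_lk].

    That the constituents exhaust the tensor product is seen on singular vectors, those
    killed by all raising operators: the component of highest index of a singular
    vector of [V (x) C^m] is a multiple of the highest weight vector of [V], so the
    weight is some [rho + mu_i] and determines the vector up to a scalar.  Group and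
    Lie algebra invariance of subspaces are compared by differentiating along
    one-parameter subgroups. *)

Import Order.TTheory GRing.Theory Num.Theory.
Import numFieldNormedType.Exports.
Local Open Scope ring_scope.
Local Open Scope complex_scope.
Local Open Scope sesquilinear_scope.

(** * The commutation relations of gl_m *)

Lemma mx_expN (R : pzRingType) m (M : 'M[R]_m) q k l :
  ((- M) ^+ q) k l = (-1) ^+ q * (M ^+ q) k l.
Proof.
rewrite (exprNn M); elim: q (M ^+ q) => [|q IH] X; first by rewrite !expr0 !mul1r.
by rewrite !exprS -!mulrA !mulN1r mxE IH.
Qed.

Section GlIdentity.
Variables (R : pzRingType) (m : nat).

(** The commutators of the matrix units, asked of a family in an arbitrary ring, so that they apply
    to the operators E_kl as well as to the dual family - E_lk. *)
Definition gl_relations (A : 'I_m -> 'I_m -> R) : Prop :=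
  forall a b c d, A a b * A c d - A c d * A a b
    = (b == c)%:R * A a d - (a == d)%:R * A c b.

Variable A : 'M[R]_m.
Hypothesis glA : gl_relations A.

(** The entries of A^p transform under the e_jk exactly as those of A do; induction on p with the
    Leibniz rule. *)
Lemma pow_bracket p j k a b :
  A j k * (A ^+ p) a b - (A ^+ p) a b * A j k
    = (k == a)%:R * (A ^+ p) j b - (j == b)%:R * (A ^+ p) a k.
Proof.
elim: p a b => [|p IH] a b.
  rewrite !expr0 !mxE ![k == a]eq_sym [j == b]eq_sym.
  have -> (x : R) (c : bool) : x * (1 *+ c) = (1 *+ c) * x.
    by case: c; rewrite ?mulr1n ?mulr0n ?mulr1 ?mul1r ?mulr0 ?mul0r.
  by rewrite subrr; case: (_ == _); case: (_ == _);
     rewrite ?(mulr0n, mulr1n, mulr1, mulr0, mul0r, mul1r, subrr).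
rewrite !exprS !mxE mulr_sumr mulr_suml -sumrB.
under eq_bigr => c _.
  rewrite -(subrKA (A a c * A j k * (A ^+ p) c b)) !mulrA -mulrBl glA -!mulrA.
  rewrite -mulrBr IH mulrBl mulrBr -!mulrA.
  over.
rewrite big_split /= !sumrB.
(* The bracket of A_jk with the first factor and the induction hypothesis each produce A_ak
   (A^p)_jb, with opposite signs, so these terms cancel. *)
have -> : \sum_i A a i * ((k == i)%:R * (A ^+ p) j b) = A a k * (A ^+ p) j b.
  rewrite (bigD1 k) //= eqxx mul1r big1 ?addr0 // => i /negPf.
  by rewrite eq_sym => ->; rewrite mul0r mulr0.
have -> : \sum_i (j == i)%:R * (A a k * (A ^+ p) i b) = A a k * (A ^+ p) j b.
  rewrite (bigD1 j) //= eqxx mul1r big1 ?addr0 // => i /negPf.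
  by rewrite eq_sym => ->; rewrite mul0r.
rewrite subrKA -mulr_sumr; congr (_ - _).
rewrite mulr_sumr; apply: eq_bigr => i _.
by case: (j == b); rewrite ?mul1r ?mul0r ?mulr0.
Qed.

(** Setting a = b in [pow_bracket] and summing over a leaves (A^p)_jk - (A^p)_jk. *)
Lemma trace_pow_central p j k : A j k * \tr (A ^+ p) = \tr (A ^+ p) * A j k.
Proof.
apply/eqP; rewrite -subr_eq0 /mxtrace mulr_sumr mulr_suml -sumrB.
under eq_bigr do rewrite pow_bracket.
rewrite sumrB (bigD1 k) //= eqxx mul1r [X in _ + X - _]big1 => [|i /negPf]; last first.
  by rewrite eq_sym => ->; rewrite mul0r.
rewrite (bigD1 j) //= eqxx mul1r big1 => [|i /negPf]; last first.
  by rewrite eq_sym => ->; rewrite mul0r.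
by rewrite !addr0 subrr.
Qed.

(** Reordering A_jk (A^p)_lj by [pow_bracket] and summing over j yields (A^(p+1))_lk, the trace of
    A^p when k = l, and - m (A^p)_lk. The shift by m cancels the last term, and the traces assemble
    into [kap q.+1], the coefficient of A^0. *)
Lemma shifted_trmx_pow (kap : nat -> R) q k l :
  (forall i j p, A i j * kap p = kap p * A i j) -> kap 0 = 1 ->
  (forall p, kap p.+1 = \sum_(j < p.+1) kap (p - j)%N * \tr (A ^+ j)) ->
  ((A^T + m%:R) ^+ q) k l = \sum_(p < q.+1) kap (q - p)%N * (A ^+ p) l k.
Proof.
move=> Ckap kap0 kapS; elim: q k l => [|q IH] k l.
  by rewrite big_ord_recl big_ord0 addr0 subnn kap0 mul1r !expr0 !mxE eq_sym.
rewrite exprS mulrDl mulr_natl mxE mulmxnE IH [X in X + _]mxE.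
under eq_bigr do rewrite IH mxE mulr_sumr.
rewrite exchange_big /= -sumrMnl -big_split [in RHS]big_ord_recl subn0 expr0.
rewrite [(1 : matrix _ _ _) _ _]mxE kapS /=.
rewrite mulr_suml -big_split; apply: eq_bigr => p _ /=.
under eq_bigr do rewrite mulrA Ckap -mulrA.
rewrite -mulr_sumr -mulrnAr -mulrDr subSS exprSr -mulrA -mulrDr.
congr (_ * _).
under eq_bigr => j _.
  rewrite -(subrK ((A ^+ p) l j * A j k) (A j k * _)) pow_bracket eqxx mul1r.
  over.
rewrite big_split sumrB /= sumr_const card_ord.
rewrite addrAC subrK -mulr_sumr addrC [RHS]addrC [in RHS]mxE; congr (_ + _).
by rewrite eq_sym; case: (_ == _); rewrite ?mul1r ?mul0r ?mulr1 ?mulr0.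
Qed.

End GlIdentity.

(** * Cyclic sums and the polynomials K_n *)

Section CyclicTrace.
Variables (R : pzRingType) (m : nat).
Implicit Types (A : 'M[R]_m).

Lemma sum_ffun_recl q (F : {ffun 'I_q.+1 -> 'I_m} -> R) k :
  \sum_(s : {ffun 'I_q.+1 -> 'I_m} | s ord0 == k) F s
    = \sum_(s : {ffun 'I_q -> 'I_m})
        F [ffun i => if unlift ord0 i is Some j then s j else k].
Proof.
rewrite (reindex_onto
  (fun s : {ffun 'I_q -> 'I_m} =>
     [ffun i => if unlift ord0 i is Some j then s j else k])
  (fun s => [ffun j => s (lift ord0 j)])) /=.
  apply: eq_bigl => s; rewrite ffunE unlift_none eqxx /=.
  by apply/eqP/ffunP => j; rewrite !ffunE liftK.
move=> s /eqP s0; apply/ffunP => i; rewrite ffunE.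
by case: unliftP => [j|] ->; rewrite ?ffunE.
Qed.

(** Here [s] lists the vertices of a path from k except its endpoint l; [unlift ord_max] singles out
    the last edge, the one that ends at l. *)
Lemma mx_pow_paths A q k l :
  (A ^+ q.+1) k l = \sum_(s : {ffun 'I_q.+1 -> 'I_m} | s ord0 == k)
     \prod_(j < q.+1) A (s j) (if unlift ord_max j is Some i then s (lift ord0 i) else l).
Proof.
elim: q k l => [|q IH] k l.
  rewrite sum_ffun_recl expr1 (big_pred1 (finfun (fun i : 'I_0 => k))) => [|s]; last first.
    by apply/esym/eqP/ffunP => -[].
  by rewrite big_ord1 ffunE unlift_none (_ : ord0 = ord_max) ?unlift_none //; apply: val_inj.
rewrite sum_ffun_recl exprS mxE (partition_big (fun s : {ffun _ -> _} => s ord0) xpredT) //=.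
apply: eq_bigr => i _; rewrite IH mulr_sumr; apply: eq_bigr => s /eqP s0.
rewrite [RHS]big_ord_recl; congr (_ * _).
  rewrite ffunE unlift_none; case: unliftP => [j e|]; last by move/(congr1 val).
  rewrite ffunE liftK (_ : j = ord0) ?s0 //; apply: val_inj; move/(congr1 val): e => /=.
  by case: j => -[|j] lj //=; rewrite /bump; case: leqP => //; rewrite ltnNge lj.
apply: eq_bigr => j _; rewrite ffunE liftK; congr (A _ _).
case: unliftP => [j'|] ->; case: unliftP => [j''|] e //.
- rewrite ffunE liftK; congr (s _); apply: val_inj; move/(congr1 val): e => /=.
  by move: (ltn_ord j') (ltn_ord j''); rewrite /= /bump; lia.
- by move/(congr1 val): e; move: (ltn_ord j'); rewrite /= /bump; lia.
- by move/(congr1 val): e; move: (ltn_ord j''); rewrite /= /bump; lia.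
Qed.

(** Closed paths: the endpoint is the starting vertex, and [ordS] wraps the last index around to
    0. *)
Lemma trace_pow_cycles A q :
  \sum_(s : {ffun 'I_q.+1 -> 'I_m}) \prod_(j < q.+1) A (s j) (s (ordS j)) = \tr (A ^+ q.+1).
Proof.
rewrite (partition_big (fun s : {ffun _ -> _} => s ord0) xpredT) //=.
apply: eq_bigr => k _; rewrite mx_pow_paths; apply: eq_bigr => s /eqP s0.
apply: eq_bigr => j _; congr (A _ _); case: unliftP => [i|] ->.
  congr (s _); apply: val_inj => /=.
  by have := ltn_ord i; rewrite /bump /= => iq; rewrite [(q <= i)%N]leqNgt iq add0n modn_small.
rewrite -s0; congr (s _); apply: val_inj => /=; exact: modnn.
Qed.

End CyclicTrace.

(** * The recursion satisfied by the polynomials K_n *)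

Section Composition.
Variables (F : numFieldType) (c : nat -> F).

Definition index_weight L (f : {ffun 'I_L -> 'I_L.+1}) := (\sum_(j < L) j.+1 * f j)%N.

Definition multicoef L (f : {ffun 'I_L -> 'I_L.+1}) : F :=
  ((\sum_(j < L) f j)`!)%N%:R / (\prod_(j < L) (f j)`!)%N%:R.

(** In [Kpoly] a single number bounds the indices, bounds the exponents and prescribes the weight.
    Separating the range L from the weight N allows sums of different weights to share an index
    set. *)
Definition Kscal L N : F :=
  \sum_(f : {ffun 'I_L -> 'I_L.+1} | index_weight f == N)
    multicoef f * \prod_(j < L) c j ^+ f j.

Lemma index_weight_ge L (f : {ffun 'I_L -> 'I_L.+1}) (j : 'I_L) : (j.+1 * f j <= index_weight f)%N.
Proof. by rewrite /index_weight (bigD1 j) //= leq_addr. Qed.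

(** In weight N the exponent of c_j enters with factor j + 1, so it is at most N and vanishes for j
    >= N; extension by zero is therefore a bijection of the index sets. *)
Lemma Kscal_widen N d : Kscal (N + d) N = Kscal N N.
Proof.
pose up (f : {ffun 'I_N -> 'I_N.+1}) : {ffun 'I_(N + d) -> 'I_(N + d).+1} :=
  [ffun i => if fintype.split i is inl j then inord (f j) else ord0].
pose dn (f : {ffun 'I_(N + d) -> 'I_(N + d).+1}) : {ffun 'I_N -> 'I_N.+1} :=
  [ffun i => inord (f (lshift d i))].
have upl f i : up f (lshift d i) = f i :> nat.
  rewrite ffunE -[lshift d i]/(unsplit (inl i)) unsplitK inordK //.
  by rewrite (leq_trans (ltn_ord _)) // ltnS leq_addr.
have upr f i : up f (rshift N i) = 0 :> nat.
  by rewrite ffunE -[rshift N i]/(unsplit (inr i)) unsplitK.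
have dnK f : dn (up f) = f by apply/ffunP => i; rewrite ffunE upl inord_val.
have wtup f : index_weight (up f) = index_weight f.
  rewrite /index_weight big_split_ord /= [X in (_ + X)%N]big1 ?addn0 => [|i _]; last by rewrite upr muln0.
  by apply: eq_bigr => i _; rewrite upl.
rewrite {1}/Kscal (reindex_onto up dn) /=.
  apply: eq_big => [f|f _]; first by rewrite dnK eqxx andbT wtup.
  rewrite /multicoef !big_split_ord /=.
  rewrite (eq_bigr (fun i => nat_of_ord (f i))) => [|i _]; last exact: upl.
  rewrite [X in (_ + X)%N]big1 ?addn0 => [|i _]; last exact: upr.
  rewrite [X in (X * _)%N%:R](eq_bigr (fun i => (f i)`!)) => [|i _]; last by rewrite upl.
  rewrite [X in (_ * X)%N%:R]big1 ?muln1 => [|i _]; last by rewrite upr.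
  rewrite [X in _ * (_ * X)]big1 ?mulr1 => [|i _]; last by rewrite upr.
  by congr (_ * _); apply: eq_bigr => i _; rewrite upl.
move=> f /eqP wf; apply/ffunP => i; apply: val_inj.
have le_i := index_weight_ge f i; rewrite wf in le_i.
case: (fintype.splitP i) => j ej.
  have ->: i = lshift d j by apply: val_inj.
  rewrite /= upl ffunE inordK //= ltnS; have := index_weight_ge f (lshift d j); rewrite wf.
  exact: leq_trans (leq_pmull _ _).
have ei : i = rshift N j by apply: val_inj.
rewrite [in LHS]ei /= upr; apply/esym/eqP; rewrite -leqn0 leqNgt; apply/negP => fi.
have := leq_trans (leq_pmulr _ fi) le_i.
by rewrite ei /= ltnNge leq_addr.
Qed.

(** The absorption rule for multinomial coefficients, used to remove one factor c_j from a
    monomial. *)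
Lemma multicoef_incr L (g h : {ffun 'I_L -> 'I_L.+1}) j :
  h j = (g j).+1 :> nat -> (forall i, i != j -> h i = g i) ->
  multicoef h * (h j)%:R / (\sum_(i < L) h i)%N%:R = multicoef g.
Proof.
move=> hj hi.
have sh : (\sum_(i < L) h i = (\sum_(i < L) g i).+1)%N.
  rewrite (bigD1 j) //= [in RHS](bigD1 j) //= hj addSn; congr (_ + _).+1.
  by apply: eq_bigr => i /hi ->.
have ph : (\prod_(i < L) (h i)`! = (g j).+1 * \prod_(i < L) (g i)`!)%N.
  rewrite (bigD1 j) //= [in RHS](bigD1 j) //= hj factS mulnA; congr (_ * _)%N.
  by apply: eq_bigr => i /hi ->.
rewrite /multicoef sh ph hj factS !natrM.
have p0 : (\prod_(i < L) (g i)`!)%N%:R != 0 :> F.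
  by rewrite pnatr_eq0 -lt0n prodn_gt0 // => i; apply: fact_gt0.
have aux (x y z t : F) : x != 0 -> y != 0 -> z != 0 -> y * t / (x * z) * x / y = t / z.
  by move=> x0 y0 z0; field; rewrite x0 y0 z0.
by apply: aux => //; rewrite pnatr_eq0.
Qed.

(** Multinomial coefficients count words with given letter multiplicities, and splitting off a first
    letter c_j lowers the weight by j + 1. In formulas, 1 = \sum_j f_j / |f| is inserted, with |f|
    the sum of the exponents, and the exponent at j is then lowered by one. *)
Lemma Kscal_rec L N : (N < L)%N ->
  Kscal L N.+1 = \sum_(j < N.+1) c j * Kscal L (N - j)%N.
Proof.
move=> NL.
transitivity (\sum_(f : {ffun 'I_L -> 'I_L.+1} | index_weight f == N.+1)
   \sum_(j < L | (0 < f j)%N) multicoef f * (f j)%:R / (\sum_(i < L) f i)%N%:R *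
      \prod_(i < L) c i ^+ f i).
  apply: eq_bigr => f /eqP wf; rewrite -mulr_suml; congr (_ * _).
  rewrite -mulr_suml -mulr_sumr -natr_sum.
  have -> : (\sum_(i < L | 0 < f i) f i = \sum_(i < L) f i)%N.
    rewrite [RHS](bigID (fun i => 0 < f i)%N) /= [X in (_ + X)%N]big1 ?addn0 // => i.
    by rewrite lt0n negbK => /eqP.
  rewrite mulfK // pnatr_eq0; apply/negP => /eqP s0; move: wf; rewrite /index_weight big1 // => i _.
  by move/eqP: s0; rewrite sum_nat_eq0 => /forallP /(_ i) /eqP ->; rewrite muln0.
rewrite (exchange_big_dep xpredT) //=.
pose inc j (g : {ffun 'I_L -> 'I_L.+1}) : {ffun 'I_L -> 'I_L.+1} :=
  [ffun i => if i == j then inord (g i).+1 else g i].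
pose dec j (g : {ffun 'I_L -> 'I_L.+1}) : {ffun 'I_L -> 'I_L.+1} :=
  [ffun i => if i == j then inord (g i).-1 else g i].
have incj j (g : {ffun 'I_L -> 'I_L.+1}) : (g j < L)%N -> inc j g j = (g j).+1 :> nat.
  by move=> ?; rewrite ffunE eqxx inordK.
have inci j (g : {ffun 'I_L -> 'I_L.+1}) i : i != j -> inc j g i = g i by move=> /negPf e; rewrite ffunE e.
transitivity (\sum_(j < L) \sum_(g : {ffun 'I_L -> 'I_L.+1} | (index_weight g + j.+1 == N.+1)%N)
   c j * (multicoef g * \prod_(i < L) c i ^+ g i)).
  apply: eq_bigr => j _.
  have wtinc (g : {ffun 'I_L -> 'I_L.+1}) : (g j < L)%N -> index_weight (inc j g) = (index_weight g + j.+1)%N.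
    move=> gL; rewrite /index_weight (bigD1 j) //= [in RHS](bigD1 j) //= incj // mulnS.
    rewrite (eq_bigr (fun i : 'I_L => (i.+1 * g i)%N)) => [|i /inci -> //].
    by rewrite -addnA addnC.
  rewrite (reindex_onto (inc j) (dec j)) /=; last first.
    move=> f /andP[_ fj]; apply/ffunP => i; apply: val_inj; have [->|ij] := eqVneq i j.
      have fL : (((f j).-1) < L)%N by rewrite prednK // -ltnS ltn_ord.
      have dj : dec j f j = (f j).-1 :> nat by rewrite ffunE eqxx inordK // ltnW.
      by rewrite /= incj; rewrite dj // prednK.
    by rewrite inci // ffunE (negPf ij).
  apply: eq_big => [g|g].
    have [gL|] := ltnP (g j) L.
      rewrite wtinc // incj //= andbT.
      suff -> : dec j (inc j g) = g by rewrite eqxx andbT.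
      apply/ffunP => i; apply: val_inj; have [->|ij] := eqVneq i j.
        by rewrite ffunE eqxx /= inordK incj // ltnW.
      by rewrite ffunE (negPf ij) inci.
    (* When g j = L, the successor is out of range and [inord] returns 0, so the condition on the
       left fails. The one on the right fails too: it bounds the weight of g by N < L, whereas g j =
       L makes it at least L. *)
    move=> Lg; rewrite [(0 < _)%N](_ : _ = false) ?andbF; last first.
      by rewrite ffunE eqxx /inord val_insubd [((g j).+1 < _)%N]ltnNge ltnS Lg.
    apply/esym/negP => /eqP e; have := index_weight_ge g j; rewrite leqNgt => /negP; apply.
    have wL : (index_weight g < L)%N by lia.
    by rewrite (leq_trans wL) // (leq_trans Lg) // leq_pmull.
  move=> /andP[/andP[/eqP w gp] _].
  have gL : (g j < L)%N.
    rewrite ltnNge; apply/negP => Lg; move: gp.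
    by rewrite ffunE eqxx /inord val_insubd [((g j).+1 < _)%N]ltnNge ltnS Lg.
  rewrite (multicoef_incr (incj j g gL)) => [|i]; last exact: inci.
  rewrite mulrCA; congr (_ * _); rewrite (bigD1 j) //= [in RHS](bigD1 j) //= incj //.
  by rewrite exprS -mulrA; congr (_ * (_ * _)); apply: eq_bigr => i /inci ->.
rewrite (bigID (fun j : 'I_L => j < N.+1)%N) /= [X in _ + X]big1 ?addr0; last first.
  move=> j; rewrite -leqNgt => jN; rewrite big_pred0 // => g.
  by apply/negP => /eqP e; move: jN; lia.
rewrite -(big_ord_widen_cond _ xpredT (fun j =>
   \sum_(g : {ffun 'I_L -> 'I_L.+1} | (index_weight g + j.+1 == N.+1)%N)
   c j * (multicoef g * \prod_(i < L) c i ^+ g i))) //.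
apply: eq_bigr => j _; rewrite /Kscal mulr_sumr; apply: eq_bigl => g.
have := ltn_ord j; rewrite ltnS => jN; rewrite addnS eqSS.
by apply/eqP/eqP; lia.
Qed.

Lemma Kscal_diag_rec N : Kscal N.+1 N.+1 = \sum_(j < N.+1) c j * Kscal (N - j)%N (N - j)%N.
Proof.
rewrite Kscal_rec //; apply: eq_bigr => j _; congr (_ * _).
have jN : (j <= N)%N by rewrite -ltnS.
by rewrite -(Kscal_widen (N - j)%N j.+1) addnS subnK.
Qed.

Lemma Kscal0 : Kscal 0 0 = 1.
Proof.
rewrite /Kscal (big_pred1 (finfun (fun _ : 'I_0 => ord0))) => [|f].
  by rewrite /multicoef !big_ord0 mulr1 divr1.
by rewrite /index_weight big_ord0; apply/esym/eqP/ffunP => -[].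
Qed.

End Composition.

(** * Adjoints and subspaces *)

Section LinearAlgebra.
Context {R : realType}.
Local Notation C := R[i].

Lemma adjmxM m n p (A : 'M[C]_(m, n)) (B : 'M_(n, p)) : (A *m B)^t* = B^t* *m A^t*.
Proof. by rewrite trmx_mul map_mxM. Qed.

Lemma adjmxD m n (A B : 'M[C]_(m, n)) : (A + B)^t* = A^t* + B^t*.
Proof. by rewrite linearD map_mxD. Qed.

Lemma adjmxN m n (A : 'M[C]_(m, n)) : (- A)^t* = - A^t*.
Proof. by rewrite linearN map_mxN. Qed.

Lemma adjmxB m n (A B : 'M[C]_(m, n)) : (A - B)^t* = A^t* - B^t*.
Proof. by rewrite adjmxD adjmxN. Qed.

Lemma adjmxZ m n a (A : 'M[C]_(m, n)) : (a *: A)^t* = Num.conj a *: A^t*.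
Proof. by rewrite linearZ map_mxZ. Qed.

Lemma adjmx1 n : (1%:M : 'M[C]_n)^t* = 1%:M.
Proof. by rewrite trmx1 map_mx1. Qed.

Lemma adjmx0 m n : (0 : 'M[C]_(m, n))^t* = 0.
Proof. by rewrite trmx0 map_mx0. Qed.

Lemma adjmx_delta m n i j : (delta_mx i j : 'M[C]_(m, n))^t* = delta_mx j i.
Proof. by rewrite trmx_delta map_delta_mx. Qed.

Lemma adjmx_sum I (r : seq I) P m n (F : I -> 'M[C]_(m, n)) :
  (\sum_(i <- r | P i) F i)^t* = \sum_(i <- r | P i) (F i)^t*.
Proof. by rewrite linear_sum /= (big_morph _ (@map_mxD _ _ _ _ _) (@map_mx0 _ _ _ _ _)). Qed.

Lemma unitarymxKV n (U : 'M[C]_n) : U \is unitarymx -> U^t* *m U = 1%:M.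
Proof. by move=> uU; rewrite -invmx_unitary // mulVmx // unitarymx_unit. Qed.

Lemma col_norm_ge0 n (v : 'cV[C]_n) : 0 <= (v^t* *m v) 0 0.
Proof. by rewrite mxE sumr_ge0 // => i _; rewrite !mxE mulrC mul_conjC_ge0. Qed.

Lemma col_norm_eq0 n (v : 'cV[C]_n) : v^t* *m v = 0 -> v = 0.
Proof.
move=> /matrixP /(_ 0 0); rewrite mxE [RHS]mxE => /eqP.
rewrite psumr_eq0 => [/allP h|i _]; last by rewrite !mxE mulrC mul_conjC_ge0.
apply/colP => i; have := h i; rewrite mem_index_enum => /(_ isT).
by rewrite !mxE mulrC mul_conjC_eq0 => /eqP.
Qed.

Lemma stablemx_colP n p (S : 'M[C]_(p, n)) (A : 'M_n) :
  stablemx S A^T <-> forall v : 'cV_n, (v^T <= S)%MS -> ((A *m v)^T <= S)%MS.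
Proof.
split=> [SA v vS|h]; first by rewrite trmx_mul (submx_trans _ SA) // submxMr.
apply/row_subP => i; rewrite row_mul -[row i S]trmxK -trmx_mul.
by apply: h; rewrite trmxK row_sub.
Qed.

Lemma mulmx_col_ext p q (A B : 'M[C]_(p, q)) :
  (forall v : 'cV_q, A *m v = B *m v) -> A = B.
Proof.
move=> h; apply/matrixP => i j.
by have := congr1 (fun X : 'cV_p => X i 0) (h (delta_mx j 0)); rewrite /= -!colE !mxE.
Qed.

Lemma submx_col_ext n p q (S : 'M[C]_(p, n)) (T : 'M_(q, n)) :
  (forall v : 'cV_n, (v^T <= S)%MS -> (v^T <= T)%MS) -> (S <= T)%MS.
Proof. by move=> h; apply/row_subP => i; rewrite -[row i S]trmxK h // trmxK row_sub. Qed.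

Lemma submx_col_sum n p (S : 'M[C]_(p, n)) (I : Type) (r : seq I) (P : pred I) (F : I -> 'cV_n) :
  (forall i, P i -> ((F i)^T <= S)%MS) -> ((\sum_(i <- r | P i) F i)^T <= S)%MS.
Proof. by move=> h; rewrite linear_sum; apply: summx_sub. Qed.

(** A matrix of maximal rank among those with rows in W spans W, since adjoining a further vector of
    W cannot raise the rank. Submodules can thus be introduced by predicates. *)
Lemma mx_of_subspace n (W : 'cV[C]_n -> Prop) :
  W 0 -> (forall a v w, W v -> W w -> W (a *: v + w)) ->
  exists S : 'M_n, forall v : 'cV_n, (v^T <= S)%MS <-> W v.
Proof.
move=> W0 Wl.
pose ok (r : nat) := `[< exists S : 'M[C]_n,
  (forall v : 'cV_n, (v^T <= S)%MS -> W v) /\ \rank S = r >].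
have ok0 : exists r, ok r.
  exists 0%N; apply/asboolP; exists 0; rewrite mxrank0; split=> // v.
  by rewrite submx0 trmx_eq0 => /eqP ->.
have okn r : ok r -> (r <= n)%N by move=> /asboolP[S [_ <-]]; apply: rank_leq_row.
case: (ex_maxnP ok0 okn) => r /asboolP[S [SW rS]] maxr.
exists S => v; split=> [|Wv]; first exact: SW.
have subW (w : 'cV_n) : (w^T <= S + v^T)%MS -> W w.
  move=> /sub_addsmxP[[a b] /= e]; rewrite -[w]trmxK e linearD /= addrC.
  rewrite [b]mx11_scalar mul_scalar_mx linearZ /= trmxK.
  by apply: Wl => //; apply: SW; rewrite trmxK submxMl.
have : (\rank (S + v^T)%MS <= r)%N.
  by apply: maxr; apply/asboolP; exists (S + v^T)%MS.
rewrite -rS => le_r.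
apply: (submx_trans (addsmxSr S v^T)).
by have := addsmxSl S v^T; rewrite (geq_leqif (mxrank_leqif_sup (addsmxSl S v^T))) // in le_r *.
Qed.

Lemma stable_eigenvector n (S A : 'M[C]_n) : S != 0 -> stablemx S A^T ->
  exists (a : C) (v : 'cV_n), [/\ v != 0, (v^T <= S)%MS & A *m v = a *: v].
Proof.
move=> S0 SA; have rS : (0 < \rank S)%N by rewrite lt0n mxrank_eq0.
have [a /eigenvalueP[v va v0]] := eigenvalue_closed (restrictmx S A^T) rS.
have SA' : stablemx (row_base S) A^T by rewrite stablemx_row_base.
exists a, (v *m row_base S)^T; split.
- by rewrite trmx_eq0 mulmx_free_eq0 // row_base_free.
- by rewrite trmxK mulmx_sub // eq_row_base.
have := sub_eigenspace_conjmx a v SA' (row_base_free S).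
move=> h; have /eigenspaceP e : (v *m row_base S <= eigenspace A^T a)%MS.
  by rewrite -h; apply/eigenspaceP.
by apply: trmx_inj; rewrite trmx_mul trmxK e linearZ /= trmxK.
Qed.

Lemma col_proj_sub n (S : 'M[C]_n) (v : 'cV_n) : ((col_proj S *m v)^T <= S)%MS.
Proof. by rewrite trmx_mul trmxK proj_ortho_sub. Qed.

Lemma col_proj_id n (S : 'M[C]_n) (v : 'cV_n) : (v^T <= S)%MS <-> col_proj S *m v = v.
Proof.
split=> [vS|<-]; last exact: col_proj_sub.
by apply: trmx_inj; rewrite trmx_mul trmxK proj_ortho_id.
Qed.

Lemma col_proj0 n : col_proj (0 : 'M[C]_n) = 0.
Proof.
apply: mulmx_col_ext => v; apply: trmx_inj; apply/eqP.
by rewrite mul0mx trmx0 -submx0 col_proj_sub.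
Qed.

Lemma col_proj_idem n (S : 'M[C]_n) : col_proj S *m col_proj S = col_proj S.
Proof. by rewrite -trmx_mul proj_ortho_proj. Qed.

(** The image of 1 - P is orthogonal to S, so P (1 - P)^* = 0 and P = P P^* is Hermitian. *)
Lemma col_proj_adj n (S : 'M[C]_n) : (col_proj S)^t* = col_proj S.
Proof.
rewrite /col_proj; set P := proj_ortho S.
have PP : P *m P = P by exact: proj_ortho_proj.
have h : P *m P^t* = P.
  have /orthomx1P := proj_ortho_compl_sub S (1%:M : 'M_n).
  rewrite mul1mx -/P => /(congr1 (fun X => X^t*)) e.
  have : S *m (1%:M - P)^t* = 0 by move: e; rewrite adjmxM trmxCK adjmx0.
  move=> {}e; have /submxP[D PD] : (P <= S)%MS by rewrite (proj_orthoE S).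
  have : P *m (1%:M - P)^t* = 0 by rewrite {1}PD -mulmxA e mulmx0.
  by rewrite adjmxB adjmx1 mulmxBr mulmx1 => /eqP; rewrite subr_eq0 => /eqP.
have e : P^t* = P by rewrite -{1}h adjmxM trmxCK h.
rewrite trmxK -{1}e.
by apply/matrixP => i j; rewrite !mxE conjCK.
Qed.

(** Stability gives P A P = A P and P A^* P = A^* P; the adjoint of the second is P A P = P A. *)
Lemma col_proj_comm n (S A : 'M[C]_n) : stablemx S A^T -> stablemx S (A^t*)^T ->
  col_proj S *m A = A *m col_proj S.
Proof.
have step (B : 'M[C]_n) : stablemx S B^T -> col_proj S *m B *m col_proj S = B *m col_proj S.
  move=> SB; apply: trmx_inj; rewrite !trmx_mul !trmxK mulmxA proj_ortho_id //.
  by rewrite (submx_trans _ SB) // submxMr // (proj_orthoE S).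
move=> /step h1 /step h2; rewrite -h1.
by rewrite -[in LHS](col_proj_adj S) -{1}[A]trmxCK -adjmxM -h2 !adjmxM trmxCK col_proj_adj mulmxA.
Qed.

End LinearAlgebra.

(** * Singular vectors in gl_m-modules *)

Section Lex.
Variable m : nat.
Implicit Types lam mu nu : 'rV[int]_m.

Lemma lex_lt_trans lam mu nu : lex_lt lam mu -> lex_lt mu nu -> lex_lt lam nu.
Proof.
move=> [k [ek lk]] [j [ej lj]]; have [kj|jk|kj] := ltngtP k j.
- exists k; split=> [i ik|]; first by rewrite ek // ej // (ltn_trans ik).
  by rewrite -ej.
- exists j; split=> [i ij|]; first by rewrite ek ?ej // (ltn_trans ij).
  by rewrite ek.
- have e : k = j by apply: val_inj.
  subst j; exists k; split=> [i ik|]; first by rewrite ek ?ej.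
  exact: lt_trans lj.
Qed.

Lemma lex_lt_irr lam : ~ lex_lt lam lam.
Proof. by case=> k [_]; rewrite ltxx. Qed.

Definition gl_root (k l : 'I_m) : 'rV[int]_m := delta_mx 0 k - delta_mx 0 l.

Lemma gl_rootE k l j : gl_root k l 0 j = (j == k)%:R - (j == l)%:R.
Proof. by rewrite !mxE eqxx. Qed.

Lemma lex_lt_root lam (k l : 'I_m) : (k < l)%N -> lex_lt lam (lam + gl_root k l).
Proof.
move=> kl; exists k; split=> [j jk|].
  rewrite !mxE eqxx /= -!val_eqE /= (ltn_eqF jk) (ltn_eqF (ltn_trans jk kl)).
  by rewrite subrr addr0.
by rewrite !mxE !eqxx -val_eqE /= (ltn_eqF kl) subr0 ltrDl.
Qed.

End Lex.

(** * Highest weight theory for gl_m-modules in which e_kl is adjoint to e_lk *)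

Section GlModule.
Context {R : realType} {m N : nat}.
Local Notation C := R[i].
Variable dpi : 'M[C]_m -> 'M[C]_N.
Local Notation E k l := (dpi (delta_mx k l)).
Hypothesis glE : gl_relations (fun k l => E k l).
Hypothesis adjE : forall k l, (E k l)^t* = E l k.
Implicit Types (v w : 'cV[C]_N) (k l : 'I_m) (lam mu : 'rV[int]_m).

Definition gl_stable p (S : 'M[C]_(p, N)) := forall k l, stablemx S (E k l)^T.

Definition gl_irreducible (S : 'M[C]_N) := [/\ S != 0, gl_stable S &
  forall T : 'M[C]_N, gl_stable T -> (T <= S)%MS -> T = 0 \/ (S <= T)%MS].

Definition singular v := forall k l, (k < l)%N -> E k l *m v = 0.

Definition has_weight lam v := forall k, E k k *m v = (lam 0 k)%:~R *: v.

Lemma gl_act k l a b v :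
  E k l *m (E a b *m v) = E a b *m (E k l *m v)
    + ((l == a)%:R *: (E k b *m v) - (k == b)%:R *: (E a l *m v)).
Proof.
have h := glE k l a b.
have bs (c : bool) (X : 'M[C]_N) : c%:R * X = (c%:R : C) *: X.
  by case: c; rewrite ?mulr1n ?mulr0n ?mul1r ?mul0r ?scale1r ?scale0r.
rewrite !bs in h; rewrite !scalemxAl -mulmxBl -h.
by rewrite !mulmxA -mulmxDl -[X in _ = X *m _]addrC subrK.
Qed.

Lemma has_weight_shift lam v k l : has_weight lam v ->
  has_weight (lam + gl_root k l) (E k l *m v).
Proof.
move=> wv j; rewrite gl_act wv -scalemxAr mxE gl_rootE !rmorphD rmorphN /= !rmorph_nat.
rewrite !scalerDl scaleNr.
have -> : (j == k)%:R *: (E j l *m v) = (j == k)%:R *: (E k l *m v).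
  by have [->|_] := eqVneq j k; rewrite ?scale0r.
have -> : (j == l)%:R *: (E k j *m v) = (j == l)%:R *: (E k l *m v).
  by have [->|_] := eqVneq j l; rewrite ?scale0r.
reflexivity.
Qed.

Lemma dot_adj k l v w : v^t* *m (E k l *m w) = (E l k *m v)^t* *m w.
Proof. by rewrite adjmxM adjE mulmxA. Qed.

Lemma dot_weights lam mu v w : has_weight lam v -> has_weight mu w -> lam != mu ->
  v^t* *m w = 0.
Proof.
move=> wv ww /eqP ne; apply/eqP; apply: contraT => n0; case: ne.
apply/rowP => k; apply/eqP; rewrite -(eqr_int C).
have /eqP := dot_adj k k v w; rewrite wv ww adjmxZ -scalemxAl -scalemxAr.
rewrite -subr_eq0 -scalerBl scaler_eq0 (negPf n0) orbF subr_eq0.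
by rewrite rmorph_int eq_sym.
Qed.

(** The space U(n^-) v0, where n^- is spanned by the lowering operators e_kl with l < k. *)
Inductive lowered (v0 : 'cV[C]_N) : 'cV[C]_N -> Prop :=
| lowered_base : lowered v0 v0
| lowered_add v w : lowered v0 v -> lowered v0 w -> lowered v0 (v + w)
| lowered_scale a v : lowered v0 v -> lowered v0 (a *: v)
| lowered_low k l v : (l < k)%N -> lowered v0 v -> lowered v0 (E k l *m v).

(** Moving e_kl past the outermost lowering operator leaves a bracket acting on a shorter word; at
    v0 itself raising operators vanish and diagonal ones are scalars. *)
Lemma lowered_act v0 lam v : singular v0 -> has_weight lam v0 -> lowered v0 v ->
  forall k l, lowered v0 (E k l *m v).
Proof.
move=> sv wv; elim=> {v} [|v w _ IHv _ IHw|a v _ IHv|a b v ba lv IHv] k l.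
- have [kl|lk|/val_inj ->] := ltngtP k l.
  + by rewrite sv // -(scale0r v0); constructor; constructor.
  + by constructor => //; constructor.
  + by rewrite wv; constructor; constructor.
- by rewrite mulmxDr; constructor.
- by rewrite -scalemxAr; constructor.
rewrite gl_act; apply: lowered_add; first exact: lowered_low.
by rewrite -scaleNr; apply: lowered_add; apply: lowered_scale.
Qed.

Lemma lowered_total (S : 'M[C]_N) v0 lam v : gl_irreducible S -> v0 != 0 ->
  (v0^T <= S)%MS -> singular v0 -> has_weight lam v0 -> (v^T <= S)%MS -> lowered v0 v.
Proof.
move=> [S0 stS irrS] n0 v0S sv wv vS.
have [|a x y lx ly|T hT] := @mx_of_subspace R N (lowered v0).
- by rewrite -(scale0r v0); constructor; constructor.
- by apply: lowered_add => //; apply: lowered_scale.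
have TS : (T <= S)%MS.
  apply: submx_col_ext => w /hT; elim=> {w} // [w x _ ? _ ?|a w _ ?|k l w _ _ wS].
  + by rewrite linearD addmx_sub.
  + by rewrite linearZ scalemx_sub.
  + by move/stablemx_colP: (stS k l); apply.
apply/hT; case: (irrS T) => // [k l|T0|ST].
- by apply/stablemx_colP => w /hT lw; apply/hT; apply: lowered_act lw k l.
- have /hT : lowered v0 v0 by constructor.
  by rewrite T0 submx0 trmx_eq0 (negPf n0).
- exact: submx_trans ST.
Qed.

(** The part u of v orthogonal to v0 is again singular. Since lowering is adjoint to raising, u is
    orthogonal to all lowered vectors; these fill S, so u is orthogonal to itself. *)
Lemma singular_unique (S : 'M[C]_N) v0 lam v : gl_irreducible S -> v0 != 0 ->
  (v0^T <= S)%MS -> singular v0 -> has_weight lam v0 ->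
  (v^T <= S)%MS -> singular v -> exists c, v = c *: v0.
Proof.
move=> irr n0 v0S sv0 wv vS sv.
pose d := (v0^t* *m v0) 0 0; pose c := (v0^t* *m v) 0 0 / d.
have d0 : d != 0.
  apply: contra n0 => /eqP d0; apply/eqP/col_norm_eq0.
  by rewrite [LHS]mx11_scalar -/d d0 raddf0.
exists c; apply/eqP; rewrite -subr_eq0; apply/eqP; set u := v - c *: v0.
have su : singular u by move=> k l kl; rewrite mulmxBr -scalemxAr sv // sv0 // scaler0 subrr.
have u0 : u^t* *m v0 = 0.
  rewrite -[LHS]trmxCK adjmxM trmxCK mulmxBr -scalemxAr.
  rewrite [v0^t* *m v]mx11_scalar [v0^t* *m v0]mx11_scalar -/d scale_scalar_mx.
  by rewrite /c divfK // subrr adjmx0.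
have uS : (u^T <= S)%MS.
  by rewrite linearB /= addmx_sub // -scaleN1r scalemx_sub // linearZ scalemx_sub.
have : lowered v0 u by apply: lowered_total irr n0 v0S sv0 wv uS.
have orth w : lowered v0 w -> u^t* *m w = 0.
  elim=> {w} // [x y _ ex _ ey|a x _ ex|k l x lk _ _].
  - by rewrite mulmxDr ex ey addr0.
  - by rewrite -scalemxAr ex scaler0.
  - by rewrite dot_adj su // adjmx0 mul0mx.
by move/orth/col_norm_eq0.
Qed.

(** A vector whose weight is not at most lam is orthogonal to v0. Moving lowering operators across
    the inner product turns them into raising ones, which only increase its weight, so it is
    orthogonal to every lowered vector. *)
Lemma singular_highest (S : 'M[C]_N) v0 lam : gl_irreducible S -> v0 != 0 ->
  (v0^T <= S)%MS -> singular v0 -> has_weight lam v0 -> is_highest_weight dpi S lam.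
Proof.
move=> irr n0 v0S sv0 wv; split; first by exists v0.
move=> mu [u [u0 uS wu]]; apply: contrapT => nle; case/eqP: u0.
have orth w : lowered v0 w -> forall nu x, ~ (nu = lam \/ lex_lt nu lam) ->
    has_weight nu x -> x^t* *m w = 0.
  elim=> {w} [|w y _ IHw _ IHy|a w _ IHw|k l w lk _ IHw] nu x nn wx.
  - by apply: dot_weights wx wv _; apply/eqP => e; apply: nn; left.
  - by rewrite mulmxDr (IHw nu) // (IHy nu) // addr0.
  - by rewrite -scalemxAr (IHw nu) // scaler0.
  - rewrite dot_adj; apply: (IHw (nu + gl_root l k)); last exact: has_weight_shift.
    move=> h; apply: nn; right; case: h => [<-|]; first exact: lex_lt_root.
    by apply: lex_lt_trans; apply: lex_lt_root.
apply: col_norm_eq0; apply: (orth u _ mu) => //.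
exact: lowered_total irr n0 v0S sv0 wv uS.
Qed.

(** A nonzero raised vector would have a lexicographically larger weight. *)
Lemma highest_singular (S : 'M[C]_N) lam : gl_stable S -> is_highest_weight dpi S lam ->
  exists v, [/\ v != 0, (v^T <= S)%MS, singular v & has_weight lam v].
Proof.
move=> stS [[v [v0 vS wv]] hi]; exists v; split=> // k l kl.
apply/eqP; apply: contraT => n0.
have [||] := hi (lam + gl_root k l).
- exists (E k l *m v); split=> //; last exact: has_weight_shift.
  by move/stablemx_colP: (stS k l); apply.
- by move=> e; have := lex_lt_root lam kl; rewrite e => /lex_lt_irr.
- by move/(lex_lt_trans (lex_lt_root lam kl))/lex_lt_irr.
Qed.

(** For k < l, the squared norm of E_lk v equals the inner product of v with E_kl E_lk v, that is
    (lam_k - lam_l) |v|^2. *)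
Lemma singular_dominant v lam : v != 0 -> singular v -> has_weight lam v -> dominant lam.
Proof.
move=> v0 sv wv; apply/forallP => k; apply/forallP => l; apply/implyP.
rewrite leq_eqVlt => /orP[/eqP/val_inj -> //|kl].
have n0 : 0 < (v^t* *m v) 0 0.
  rewrite lt_neqAle col_norm_ge0 andbT eq_sym; apply: contra v0 => /eqP e.
  by apply/eqP/col_norm_eq0; rewrite [LHS]mx11_scalar e raddf0.
have := col_norm_ge0 (E l k *m v).
rewrite -dot_adj gl_act sv // mulmx0 add0r !eqxx !scale1r !wv.
rewrite -scalerBl -scalemxAr mxE -rmorphB /= pmulr_lge0 //.
by rewrite ler0z subr_ge0.
Qed.

Lemma singular_diag v j : singular v -> singular (E j j *m v).
Proof.
move=> sv k l kl; rewrite gl_act sv // mulmx0 add0r.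
have [e|_] := eqVneq l j; have [e'|_] := eqVneq k j.
- by rewrite e e' ltnn in kl.
- by rewrite scale1r scale0r subr0 -e sv.
- by rewrite scale1r scale0r sub0r -e' sv // oppr0.
- by rewrite !scale0r subrr.
Qed.

Lemma exists_irreducible (S : 'M[C]_N) : S != 0 -> gl_stable S ->
  exists T : 'M_N, gl_irreducible T /\ (T <= S)%MS.
Proof.
have [r] := ubnP (\rank S); elim: r S => [|r IH] S rS S0 stS //.
have [irr|nirr] := pselect (gl_irreducible S); first by exists S.
have [T [stT TS T0 nST]] : exists T : 'M_N,
    [/\ gl_stable T, (T <= S)%MS, T <> 0 & ~ (S <= T)%MS].
  apply: contrapT => h; apply: nirr; split=> // T stT TS.
  have [T0|T0] := pselect (T = 0); first by left.
  by right; apply: contrapT => nST; apply: h; exists T.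
have rT : (\rank T < \rank S)%N.
  by rewrite (ltn_leqif (mxrank_leqif_sup TS)); apply/negP.
have [||U [irrU UT]] := IH T _ _ stT; first exact: leq_trans rT rS.
  by apply/eqP.
by exists U; split=> //; apply: submx_trans UT TS.
Qed.

Lemma gl_schur (S X : 'M[C]_N) : gl_irreducible S -> stablemx S X^T ->
  (forall k l, X *m E k l = E k l *m X) ->
  exists a : C, forall v, (v^T <= S)%MS -> X *m v = a *: v.
Proof.
move=> [S0 stS irrS] sX cX; have [a [v0 [n0 v0S e0]]] := stable_eigenvector S0 sX.
exists a; have [||T hT] := @mx_of_subspace R N (fun v => (v^T <= S)%MS /\ X *m v = a *: v).
- by rewrite trmx0 sub0mx mulmx0 scaler0.
- move=> b v w [vS ev] [wS ew]; split.
    by rewrite linearP addmx_sub // scalemx_sub.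
  by rewrite mulmxDr -scalemxAr ev ew scalerDr !scalerA mulrC.
have [k l||T0|ST v vS] := irrS T.
- apply/stablemx_colP => v /hT[vS ev]; apply/hT; split.
    by move/stablemx_colP: (stS k l); apply.
  by rewrite mulmxA cX -mulmxA ev scalemxAr.
- by apply: submx_col_ext => v /hT[].
- have /hT : (v0^T <= S)%MS /\ X *m v0 = a *: v0 by [].
  by rewrite T0 submx0 trmx_eq0 (negPf n0).
- by have /hT[] : (v^T <= T)%MS by apply: submx_trans ST.
Qed.

Lemma exists_max_Re (P : C -> Prop) (s : seq C) : (forall a, P a -> a \in s) ->
  (exists a, P a) -> exists2 a, P a & forall b, P b -> complex.Re b <= complex.Re a.
Proof.
elim: s P => [|x s IH] P Ps [a Pa]; first by have := Ps _ Pa.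
have [h|h] := pselect (exists a, P a /\ a != x); last first.
  exists a => // b Pb; have -> : b = a; last by [].
  have ex c : P c -> c = x by move=> Pc; apply/eqP; apply: contraT => cx; case: h; exists c.
  by rewrite (ex a) // (ex b).
have [|c [Pc cx] cmax] := IH (fun a => P a /\ a != x) _ h.
  by move=> b [/Ps]; rewrite inE => /orP[->|].
have [Px|nPx] := pselect (P x); last first.
  by exists c => // b Pb; apply: cmax; split=> //; apply/eqP => e; rewrite e in Pb.
have [le|/ltW le] := leP (complex.Re c) (complex.Re x).
  exists x => // b Pb; have [-> //|bx] := eqVneq b x.
  by apply: le_trans le; apply: cmax.
by exists c => // b Pb; have [-> //|bx] := eqVneq b x; apply: cmax.
Qed.

(* Raising operators strictly increase the eigenvalue of [sum_k (m - k) E_kk], so an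
   eigenvector of maximal eigenvalue is singular. *)
Lemma exists_singular (S : 'M[C]_N) : S != 0 -> gl_stable S ->
  exists v, [/\ v != 0, (v^T <= S)%MS & singular v].
Proof.
move=> S0 stS; pose H := \sum_(k < m) (m - k)%:R *: E k k.
have stH : stablemx S H^T.
  apply/stablemx_colP => v vS; rewrite mulmx_suml; apply: submx_col_sum => k _.
  by rewrite -scalemxAl linearZ scalemx_sub //; move/stablemx_colP: (stS k k); apply.
pose P a := exists v, [/\ v != 0, (v^T <= S)%MS & H *m v = a *: v].
have [||a [v [v0 vS va]] amax] := @exists_max_Re P (sval (closed_field_poly_normal (char_poly H^T))).
- move=> a [v [v0 vS va]].
  have: eigenvalue H^T a.
    apply/eigenvalueP; exists v^T; last by rewrite trmx_eq0.
    by rewrite -trmx_mul va linearZ.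
  rewrite eigenvalue_root_char; case: closed_field_poly_normal => s /= ->.
  by rewrite (monicP (char_poly_monic _)) scale1r root_prod_XsubC.
- exact: stable_eigenvector S0 stH.
exists v; split=> // k l kl; apply/eqP; apply: contraT => n0.
have Hkl : H *m (E k l *m v) = (a + (l - k)%:R) *: (E k l *m v).
  rewrite scalerDl [a *: (_ *m _)]scalemxAr -va !mulmx_suml mulmx_sumr.
  under eq_bigr do rewrite -scalemxAl gl_act scalerDr.
  rewrite big_split /=; congr (_ + _).
    by apply: eq_bigr => i _; rewrite -scalemxAl -scalemxAr.
  under eq_bigr do rewrite scalerBr.
  rewrite sumrB (bigD1 k isT) /= eqxx scale1r big1 => [|i /negPf ->]; last by rewrite scale0r scaler0.
  rewrite (bigD1 l isT) /= eqxx scale1r big1 => [|i /negPf ->]; last by rewrite scale0r scaler0.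
  rewrite !addr0 -scalerBl -natrB ?leq_sub2l ?(ltnW kl) //; congr (_%:R *: _).
  by have := ltn_ord l; have := kl; lia.
have /amax : P (a + (l - k)%:R).
  by exists (E k l *m v); split=> //; move/stablemx_colP: (stS k l); apply.
rewrite raddfD /= gerDl -(rmorph_nat (@real_complex R)) /= leNgt ltr0n subn_gt0 kl //.
Qed.

End GlModule.

(** * Singular vectors in tensor products *)

Section TensorSingular.
Context {R : realType} {m n N : nat}.
Local Notation C := R[i].
Variables (F : 'I_m -> 'I_m -> 'M[C]_n) (FT : 'I_m -> 'I_m -> 'M[C]_N).
Variables (J : 'I_m -> 'M[C]_(N, n)) (r : 'I_m -> nat).
Variables (v0 : 'cV[C]_n) (w : 'I_m -> C).
Local Notation comp j v := ((J j)^t* *m v).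

Implicit Types (u v : 'cV[C]_N).

(** The rank function r lets one argument serve both tensor products: r k = k with F_kl = E_kl, and
    r k = m - k with F_kl = - E_lk, which is a raising operator for k > l. *)
Definition singular_for (D : nat) (X : 'I_m -> 'I_m -> 'M[C]_D) (v : 'cV[C]_D) :=
  forall k l, (r k < r l)%N -> X k l *m v = 0.

(** The operator \sum_ab F_ab (x) e_ba. It is half the difference between the quadratic Casimir of
    the tensor product and those of its two factors, which is why it commutes with the action. *)
Definition tensor_casimir : 'M[C]_N := \sum_a \sum_b J b *m F a b *m (J a)^t*.

Hypothesis r_inj : injective r.
Hypothesis glF : gl_relations F.
Hypothesis JJ : forall k l, (J k)^t* *m J l = (k == l)%:R%:M.
Hypothesis sumJ : \sum_k J k *m (J k)^t* = 1%:M.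
Hypothesis JF : forall j k l,
  (J j)^t* *m FT k l = F k l *m (J j)^t* + (k == j)%:R *: (J l)^t*.
Hypothesis v0_weight : forall k, F k k *m v0 = w k *: v0.
Hypothesis v0_unique : forall x, singular_for F x -> exists c, x = c *: v0.

Definition tensor_weight i (v : 'cV[C]_N) :=
  forall k, FT k k *m v = (w k + (k == i)%:R) *: v.

Lemma comp_ext v : (forall j, comp j v = 0) -> v = 0.
Proof.
move=> h; rewrite -(mul1mx v) -sumJ mulmx_suml big1 // => k _.
by rewrite -mulmxA h mulmx0.
Qed.

Lemma comp_act j k l v :
  comp j (FT k l *m v) = F k l *m comp j v + (k == j)%:R *: comp l v.
Proof. by rewrite mulmxA JF mulmxDl -mulmxA -scalemxAl. Qed.

Lemma leading_exists v : v != 0 ->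
  exists2 j, comp j v != 0 & forall i, (r j < r i)%N -> comp i v = 0.
Proof.
move=> nv; have [j0 nj0] : exists j, comp j v != 0.
  apply: contrapT => h; case/eqP: nv; apply: comp_ext => j.
  by apply/eqP; apply: contraT => ?; case: h; exists j.
case: (@arg_maxnP _ j0 (fun j => comp j v != 0) r nj0) => j nj jmax.
exists j => // i ij; apply/eqP; apply: contraT => /jmax.
by rewrite /= leqNgt ij.
Qed.

(** Component j of FT_kl v = 0 reads F_kl v_j + \delta_kj v_l = 0, and v_l = 0 if k = j because l
    then lies above the leading index. Hence v_j is singular in V. *)
Lemma leading_multiple v j : singular_for FT v ->
  (forall i, (r j < r i)%N -> comp i v = 0) -> exists c, comp j v = c *: v0.
Proof.
move=> sv h; apply: v0_unique => k l kl; have := comp_act j k l v.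
rewrite sv // mulmx0; have [e|_] := eqVneq k j.
  by rewrite (h l) -?e // scaler0 addr0.
by rewrite scale0r addr0.
Qed.

(** At the leading index j, FT_jj acts on the component v_j by w_j from the first factor plus 1 from
    the second; comparison with w_j + \delta_ji forces j = i. *)
Lemma tensor_weight_leading v i : v != 0 -> singular_for FT v -> tensor_weight i v ->
  comp i v != 0 /\ forall j, (r i < r j)%N -> comp j v = 0.
Proof.
move=> nv sv wv; have [j nj hj] := leading_exists nv.
suff <- : j = i by [].
have [c ec] := leading_multiple sv hj.
have /eqP := comp_act j j j v; rewrite wv -scalemxAr eqxx.
rewrite {2}ec -scalemxAr v0_weight scalerA mulrC -scalerA -ec -scalerDl.
rewrite -subr_eq0 -scalerBl scaler_eq0 (negPf nj) orbF.
rewrite opprD addrACA subrr add0r; have [//|_] := eqVneq j i.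
by rewrite sub0r oppr_eq0 oner_eq0.
Qed.

Lemma tensor_singular_eq0 v i : singular_for FT v -> tensor_weight i v ->
  comp i v = 0 -> v = 0.
Proof.
move=> sv wv; have [//|nv] := eqVneq v 0.
by have [/eqP] := tensor_weight_leading nv sv wv.
Qed.

(** Both components at i are multiples of [v0], so a combination of u and v has none there, and by
    [tensor_singular_eq0] it vanishes. *)
Lemma tensor_singular_unique u v i : u != 0 -> singular_for FT u -> tensor_weight i u ->
  singular_for FT v -> tensor_weight i v -> exists c, v = c *: u.
Proof.
move=> nu su wu sv wv; have [nui hu] := tensor_weight_leading nu su wu.
have hv j : (r i < r j)%N -> comp j v = 0.
  have [->|nv] := eqVneq v 0; first by rewrite mulmx0.
  by case: (tensor_weight_leading nv sv wv) => _; apply.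
have [c ec] := leading_multiple su hu; have [d ed] := leading_multiple sv hv.
have c0 : c != 0 by apply: contra nui => /eqP c0; rewrite ec c0 scale0r.
exists (d / c); apply/eqP; rewrite -subr_eq0; apply/eqP.
apply: (@tensor_singular_eq0 _ i).
- by move=> k l kl; rewrite mulmxBr -scalemxAr sv // su // scaler0 subrr.
- by move=> k; rewrite mulmxBr -scalemxAr wv wu scalerBr !scalerA mulrC.
- by rewrite mulmxBr -scalemxAr ec ed scalerA divfK // subrr.
Qed.

(** Let v have leading index j. If some FT_kk does not act on v by w_k + \delta_kj, then applying
    FT_kk minus this scalar kills component j and gives a nonzero vector of W with a smaller leading
    index. *)
Lemma tensor_singular_exists (W : 'cV[C]_N -> Prop) v :
  (forall a x y, W x -> W y -> W (a *: x + y)) ->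
  (forall k x, W x -> W (FT k k *m x)) ->
  (forall x, W x -> singular_for FT x) -> W v -> v != 0 ->
  exists i x, [/\ x != 0, W x & tensor_weight i x].
Proof.
move=> Wl WF Ws; have [b] : exists b, forall j, comp j v != 0 -> (r j < b)%N.
  exists (\max_j (r j)).+1 => j _; rewrite ltnS; exact: leq_bigmax.
elim: b v => [|b IH] v hb Wv nv.
  by have [j /hb] := leading_exists nv.
have [j nj hj] := leading_exists nv.
have [c ec] := leading_multiple (Ws _ Wv) hj.
have [allk|] := pselect (tensor_weight j v); first by exists j, v.
move/existsNP => [k nk]; pose x := (- (w k + (k == j)%:R)) *: v + FT k k *m v.
apply: (IH x); last 2 first.
- by apply: Wl => //; apply: WF.
- by rewrite /x addrC scaleNr subr_eq0; apply/eqP.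
move=> i; rewrite ltnNge => ni; apply/negP => bi; case/eqP: ni.
have ji : (r j <= r i)%N by apply: leq_trans bi; rewrite -ltnS hb.
rewrite mulmxDr -scalemxAr comp_act; move: ji.
rewrite leq_eqVlt => /orP[/eqP /r_inj <-|ji].
  have -> : F k k *m comp j v = w k *: comp j v.
    by rewrite ec -scalemxAr v0_weight !scalerA mulrC.
  have -> : (k == j)%:R *: comp k v = (k == j)%:R *: comp j v.
    by have [->|_] := eqVneq k j; rewrite ?scale0r.
  by rewrite -scalerDl -scalerDl addNr scale0r.
rewrite (hj _ ji) scaler0 add0r mulmx0 add0r.
by have [->|_] := eqVneq k i; rewrite ?(hj _ ji) ?scaler0 ?scale0r.
Qed.

Lemma comp_casimir b v : comp b (tensor_casimir *m v) = \sum_a F a b *m comp a v.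
Proof.
rewrite mulmxA mulmx_sumr mulmx_suml; apply: eq_bigr => a _.
rewrite mulmx_sumr (bigD1 b) //= big1 => [|c cb].
  by rewrite addr0 !mulmxA JJ eqxx mul1mx.
by rewrite !mulmxA JJ eq_sym (negPf cb) raddf0 !mul0mx.
Qed.

Lemma casimir_comm k l v : FT k l *m (tensor_casimir *m v) = tensor_casimir *m (FT k l *m v).
Proof.
apply/eqP; rewrite -subr_eq0; apply/eqP; apply: comp_ext => j.
rewrite mulmxBr comp_act !comp_casimir mulmx_sumr.
under [X in _ - X]eq_bigr do rewrite comp_act mulmxDr.
rewrite big_split /= opprD addrACA -sumrB.
under [X in X + _ = _]eq_bigr => a _.
  rewrite [F k l *m (_ *m _)]mulmxA [F a j *m (F k l *m _)]mulmxA -mulmxBl.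
  have -> : F k l *m F a j - F a j *m F k l = (l == a)%:R *: F k j - (k == j)%:R *: F a l.
    rewrite -[_ *m _]/(_ * _) -[F a j *m _]/(_ * _) glF.
    by congr (_ - _); case: (_ == _); rewrite ?mulr1n ?mulr0n ?mul1r ?mul0r ?scale1r ?scale0r.
  rewrite mulmxBl -!scalemxAl.
  over.
rewrite sumrB (bigD1 l) //= eqxx scale1r big1 => [|a]; last first.
  by rewrite eq_sym => /negPf ->; rewrite scale0r.
rewrite addr0 -scaler_sumr.
have -> : \sum_a F a j *m ((k == a)%:R *: comp l v) = F k j *m comp l v.
  rewrite (bigD1 k) //= eqxx scale1r big1 ?addr0 // => a.
  by rewrite eq_sym => /negPf ->; rewrite scale0r mulmx0.
by rewrite addrA subrK subrr.
Qed.

(** It suffices to compare components at i, where B v has \sum_a F_ai v_a. The term a = i gives w_i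
    v_i; each a below i gives - v_i, by component a of FT_ai v = 0; those above i vanish. *)
Lemma tensor_casimir_singular v i : singular_for FT v -> tensor_weight i v ->
  tensor_casimir *m v = (w i - (\sum_(a | (r a < r i)%N) 1)%:R) *: v.
Proof.
move=> sv wv; have [->|nv] := eqVneq v 0; first by rewrite mulmx0 scaler0.
have [_ hv] := tensor_weight_leading nv sv wv; have [c ec] := leading_multiple sv hv.
apply/eqP; rewrite -subr_eq0; apply/eqP; apply: (@tensor_singular_eq0 _ i).
- move=> k l kl; rewrite mulmxBr -scalemxAr casimir_comm sv //.
  by rewrite mulmx0 scaler0 subrr.
- move=> k; rewrite mulmxBr -scalemxAr casimir_comm wv -scalemxAr scalerBr.
  by rewrite !scalerA mulrC.
rewrite mulmxBr -scalemxAr comp_casimir (bigD1 i) //=.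
rewrite {1}ec -scalemxAr v0_weight scalerA mulrC -scalerA -ec.
rewrite (bigID (fun a => r a < r i)%N) /= [X in _ + (_ + X)]big1; last first.
  move=> a /andP[ai]; rewrite -leqNgt leq_eqVlt => /orP[/eqP/r_inj e|/hv ->].
    by rewrite e eqxx in ai.
  by rewrite mulmx0.
have -> : \sum_(a | (a != i) && (r a < r i)%N) F a i *m comp a v
   = \sum_(a | (r a < r i)%N) (- comp i v).
  apply: eq_big => [a|a /andP[_ ai]].
    by case: eqVneq => // ->; rewrite ltnn.
  apply/eqP; rewrite -addr_eq0; apply/eqP.
  by have := comp_act a a i v; rewrite sv // mulmx0 eqxx scale1r.
rewrite addr0 sumr_const sum1_card mulNrn -scaler_nat -scaleNr -scalerDl subrr //.
Qed.

End TensorSingular.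

(** * One-parameter subgroups *)

Section Velocity.
Context {R : realType}.
Local Notation C := R[i].

Definition cvelocity (f : R -> C) (z : C) : Prop :=
  is_derive (0 : R) 1 (fun t => complex.Re (f t)) (complex.Re z) /\
  is_derive (0 : R) 1 (fun t => complex.Im (f t)) (complex.Im z).

Lemma cvelocity_cst (z : C) : cvelocity (fun=> z) 0.
Proof. by split; apply: is_derive_cst. Qed.

Lemma cvelocityD f g z w : cvelocity f z -> cvelocity g w ->
  cvelocity (fun t => f t + g t) (z + w).
Proof.
move=> [f1 f2] [g1 g2]; split; rewrite raddfD.
- rewrite (_ : (fun t => _) = (fun t => complex.Re (f t)) + (fun t => complex.Re (g t))).
    exact: is_deriveD.
  by apply/funext => t; rewrite raddfD.
- rewrite (_ : (fun t => _) = (fun t => complex.Im (f t)) + (fun t => complex.Im (g t))).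
    exact: is_deriveD.
  by apply/funext => t; rewrite raddfD.
Qed.

Lemma Re_complexD (x y : C) : complex.Re (x + y) = complex.Re x + complex.Re y.
Proof. exact: raddfD. Qed.

Lemma Im_complexD (x y : C) : complex.Im (x + y) = complex.Im x + complex.Im y.
Proof. exact: raddfD. Qed.

Lemma Re_complexM (x y : C) : complex.Re (x * y)
  = complex.Re x * complex.Re y - complex.Im x * complex.Im y.
Proof. by case: x y => [a b] [c d]. Qed.

Lemma Im_complexM (x y : C) : complex.Im (x * y)
  = complex.Re x * complex.Im y + complex.Im x * complex.Re y.
Proof. by case: x y => [a b] [c d]. Qed.

Lemma cvelocityM f g z w : cvelocity f z -> cvelocity g w ->
  cvelocity (fun t => f t * g t) (z * g 0 + f 0 * w).
Proof.
move=> [f1 f2] [g1 g2]; split.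
- rewrite (_ : (fun t => _) = (fun t => complex.Re (f t)) * (fun t => complex.Re (g t))
     - (fun t => complex.Im (f t)) * (fun t => complex.Im (g t))); last first.
    by apply/funext => t; rewrite Re_complexM.
  apply: (is_derive_eq (is_deriveB (is_deriveM f1 g1) (is_deriveM f2 g2))).
  by rewrite Re_complexD !Re_complexM /GRing.scale /=; lra.
- rewrite (_ : (fun t => _) = (fun t => complex.Re (f t)) * (fun t => complex.Im (g t))
     + (fun t => complex.Im (f t)) * (fun t => complex.Re (g t))); last first.
    by apply/funext => t; rewrite Im_complexM.
  apply: (is_derive_eq (is_deriveD (is_deriveM f1 g2) (is_deriveM f2 g1))).
  by rewrite Im_complexD !Im_complexM /GRing.scale /=; lra.
Qed.

Lemma cvelocity_conj f z : cvelocity f z -> cvelocity (fun t => Num.conj (f t)) (Num.conj z).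
Proof.
move=> [f1 f2]; split.
- rewrite (_ : (fun t => _) = (fun t => complex.Re (f t))); last first.
    by apply/funext => t; case: (f t).
  by apply: (is_derive_eq f1); case: (z).
- rewrite (_ : (fun t => _) = - (fun t => complex.Im (f t))); last first.
    by apply/funext => t; rewrite fctE; case: (f t).
  by apply: (is_derive_eq (is_deriveN f2)); case: (z).
Qed.

Lemma cvelocity_opp f z : cvelocity f z -> cvelocity (fun t => f (- t)) (- z).
Proof.
move=> [f1 f2].
have d : is_derive (0 : R) 1 (-%R : R -> R) (- 1) by apply: is_deriveN.
split; rewrite raddfN -mulrN1.
- by apply: (@is_derive1_comp _ (fun t => complex.Re (f t)) -%R) => //; rewrite oppr0.
- by apply: (@is_derive1_comp _ (fun t => complex.Im (f t)) -%R) => //; rewrite oppr0.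
Qed.

Lemma cvelocity_uniq f z w : cvelocity f z -> cvelocity f w -> z = w.
Proof.
move=> [f1 f2] [g1 g2]; apply/eqP; rewrite eq_complex.
rewrite -(@derive_val _ _ _ _ _ _ _ f1) -(@derive_val _ _ _ _ _ _ _ g1).
by rewrite -(@derive_val _ _ _ _ _ _ _ f2) -(@derive_val _ _ _ _ _ _ _ g2) !eqxx.
Qed.

Lemma cvelocity_sum I (s : seq I) (f : I -> R -> C) (z : I -> C) :
  (forall i, cvelocity (f i) (z i)) ->
  cvelocity (fun t => \sum_(i <- s) f i t) (\sum_(i <- s) z i).
Proof.
move=> h; elim: s => [|i s IH].
  rewrite big_nil (_ : (fun t => _) = fun=> 0); first exact: cvelocity_cst.
  by apply/funext => t; rewrite big_nil.
rewrite big_cons (_ : (fun t => _) = fun t => f i t + \sum_(j <- s) f j t).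
  exact: cvelocityD.
by apply/funext => t; rewrite big_cons.
Qed.

Lemma cvelocity_const f : (forall t, cvelocity (fun s => f (t + s)) 0) ->
  forall t, f t = f 0.
Proof.
move=> h t.
(* Velocities are taken at 0 only, so the derivative at x is read off from a translate. *)
have shift (g : R -> R) x : is_derive (0 : R) 1 (fun s => g (x + s)) 0 -> is_derive x 1 g 0.
  move=> dg; have e : g = (fun s => g (x + s)) \o (fun s : R => s - x).
    by apply/funext => s /=; rewrite addrC subrK.
  rewrite e -[X in is_derive _ _ _ X](mul0r 1); apply: is_derive1_comp; first by rewrite subrr.
  have : is_derive x 1 ((id : R -> R) + cst (- x)) (1 + 0) by apply: is_deriveD.
  by rewrite addr0.
have d1 x : is_derive (x : R) 1 (fun t => complex.Re (f t)) 0.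
  by have [r1 r2] := h x; exact: (shift (fun t => complex.Re (f t))).
have e1 : complex.Re (f t) = complex.Re (f 0) := is_derive_0_is_cst t 0 d1.
have d2 x : is_derive (x : R) 1 (fun t => complex.Im (f t)) 0.
  by have [r1 r2] := h x; exact: (shift (fun t => complex.Im (f t))).
have e2 : complex.Im (f t) = complex.Im (f 0) := is_derive_0_is_cst t 0 d2.
by apply/eqP; rewrite eq_complex e1 e2 !eqxx.
Qed.

Lemma velocityP N (g : R -> 'M[C]_N) X :
  has_velocity g X <-> forall i j, cvelocity (fun t => g t i j) (X i j).
Proof. by []. Qed.

Lemma velocity_cst N (M : 'M[C]_N) : has_velocity (fun=> M) 0.
Proof. by move=> i j; rewrite mxE; apply: cvelocity_cst. Qed.

Lemma velocityM N (f g : R -> 'M[C]_N) X Y : has_velocity f X -> has_velocity g Y ->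
  has_velocity (fun t => f t *m g t) (X *m g 0 + f 0 *m Y).
Proof.
move=> hf hg; apply/velocityP => i j; rewrite !mxE -big_split /=.
rewrite (_ : (fun t => _) = fun t => \sum_k f t i k * g t k j); last first.
  by apply/funext => t; rewrite mxE.
by apply: cvelocity_sum => k; apply: cvelocityM; [apply: hf|apply: hg].
Qed.

Lemma velocity_mulr N (f : R -> 'M[C]_N) X M : has_velocity f X ->
  has_velocity (fun t => f t *m M) (X *m M).
Proof. by move=> hf; have := velocityM hf (velocity_cst M); rewrite mulmx0 addr0. Qed.

Lemma velocity_mull N (f : R -> 'M[C]_N) X M : has_velocity f X ->
  has_velocity (fun t => M *m f t) (M *m X).
Proof. by move=> hf; have := velocityM (velocity_cst M) hf; rewrite mul0mx add0r. Qed.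

Lemma velocity_adj N (f : R -> 'M[C]_N) X : has_velocity f X ->
  has_velocity (fun t => (f t)^t*) (X^t*).
Proof.
move=> hf; apply/velocityP => i j; rewrite !mxE.
rewrite (_ : (fun t => _) = fun t => Num.conj (f t j i)); last first.
  by apply/funext => t; rewrite !mxE.
by apply: cvelocity_conj; apply: hf.
Qed.

Lemma velocity_opp N (f : R -> 'M[C]_N) X : has_velocity f X ->
  has_velocity (fun t => f (- t)) (- X).
Proof.
move=> hf; apply/velocityP => i j; rewrite !mxE.
by apply: (@cvelocity_opp (fun t => f t i j)); apply: hf.
Qed.

Lemma velocity_uniq N (f : R -> 'M[C]_N) X Y : has_velocity f X -> has_velocity f Y -> X = Y.
Proof.
move=> hX hY; apply/matrixP => i j; apply: (@cvelocity_uniq (fun t => f t i j)); [exact: hX|exact: hY].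
Qed.

Lemma velocity_const N (f : R -> 'M[C]_N) : (forall t, has_velocity (fun s => f (t + s)) 0) ->
  forall t, f t = f 0.
Proof.
move=> h t; apply/matrixP => i j; apply: (@cvelocity_const (fun t => f t i j)) => x.
by have := h x i j; rewrite mxE.
Qed.

Lemma velocity_tens n m (f : R -> 'M[C]_n) (g : R -> 'M[C]_m) X Y :
  has_velocity f X -> has_velocity g Y ->
  has_velocity (fun t => f t *t g t) (X *t g 0 + f 0 *t Y).
Proof.
move=> hf hg; apply/velocityP => i j.
case: (mxtens_indexP i) => i1 i2; case: (mxtens_indexP j) => j1 j2.
rewrite mxE !tensmxE (_ : (fun t => _) = fun t => f t i1 j1 * g t i2 j2); last first.
  by apply/funext => t; rewrite tensmxE.
by apply: cvelocityM; [apply: hf|apply: hg].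
Qed.

Lemma velocity_linear m N (L : 'M[C]_m -> 'M[C]_N) (f : R -> 'M[C]_m) X :
  (forall a Y Z, L (a *: Y + Z) = a *: L Y + L Z) -> has_velocity f X ->
  has_velocity (fun t => L (f t)) (L X).
Proof.
move=> Ll hf.
have L0 : L 0 = 0 by have := Ll (-1) 0 0; rewrite scaler0 addr0 scaleN1r addNr.
have LE Y : L Y = \sum_(p : 'I_m * 'I_m) Y p.1 p.2 *: L (delta_mx p.1 p.2).
  rewrite {1}(matrix_sum_delta Y) pair_big /= (big_morph L (id1 := 0) (op1 := +%R)) //.
    by apply: eq_bigr => p _; rewrite -[X in L X]addr0 Ll L0 addr0.
  by move=> Y1 Y2; rewrite -[Y1]scale1r Ll !scale1r.
apply/velocityP => i j; rewrite LE summxE.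
rewrite (_ : (fun t => _) = fun t =>
    \sum_(p : 'I_m * 'I_m) f t p.1 p.2 * L (delta_mx p.1 p.2) i j); last first.
  by apply/funext => t; rewrite LE summxE; apply: eq_bigr => p _; rewrite mxE.
apply: cvelocity_sum => p; rewrite mxE -[X in cvelocity _ X]addr0 -[X in _ + X](mulr0 (f 0 p.1 p.2)).
by apply: (@cvelocityM (fun t => f t p.1 p.2)); [apply: hf|apply: cvelocity_cst].
Qed.

End Velocity.

(** * Exponentials of skew-Hermitian matrices and logarithms of unitary ones *)

Section OneParameter.
Context {R : realType} {m : nat}.
Local Notation C := R[i].

Definition cis (t : R) : C := cos t +i* sin t.

Lemma cisD s t : cis (s + t) = cis s * cis t.
Proof.
by apply/eqP; rewrite eq_complex Re_complexM Im_complexM /= cosD sinD addrC [cos s * sin t + _]addrC !eqxx.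
Qed.

Lemma cis_conj t : cis t * Num.conj (cis t) = 1.
Proof.
apply/eqP; rewrite eq_complex Re_complexM Im_complexM /= mulrN opprK -!expr2 cos2Dsin2 eqxx /=.
by rewrite mulrN mulrC addNr.
Qed.

Lemma cis_surj (z : C) : z * Num.conj z = 1 -> exists t, z = cis t.
Proof.
case: z => a b /eqP; rewrite eq_complex Re_complexM Im_complexM /= mulrN opprK -!expr2 => /andP[/eqP ab _].
have a1 : -1 <= a <= 1 by rewrite -ler_norml -(@expr_le1 _ 2) // real_normK ?num_real // -ab lerDl sqr_ge0.
have sb : sin (acos a) = `|b| by rewrite sin_acos // -ab addrAC subrr add0r sqrtr_sqr.
have [b0|b0] := leP 0 b.
  by exists (acos a); rewrite /cis acosK // sb ger0_norm.
by exists (- acos a); rewrite /cis cosN sinN acosK // sb ltr0_norm // opprK.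
Qed.

Lemma cvelocity_cis (a : R) : cvelocity (fun t => cis (t * a)) (0 +i* a).
Proof.
have d : is_derive (0 : R) 1 (fun t : R => t * a) a.
  have := @is_deriveM _ _ (id : R -> R) (cst a) 0 1 _ _ (is_derive_id _ _) (is_derive_cst _ _ _).
  by rewrite /GRing.scale /= mulr0 add0r mulr1.
split.
- have := @is_derive1_comp _ (@cos R) (fun t => t * a) 0 _ _ (is_derive_cos _) d.
  by rewrite mul0r sin0 oppr0 mul0r.
- have := @is_derive1_comp _ (@sin R) (fun t => t * a) 0 _ _ (is_derive_sin _) d.
  by rewrite mul0r cos0 mul1r.
Qed.

(** For unitary P this is exp (t X) with X = P^* diag(i a_j) P, written without a matrix
    exponential. *)
Definition torus_subgroup (P : 'M[C]_m) (a : 'I_m -> R) (t : R) : 'M[C]_m :=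
  P^t* *m diag_mx (\row_j cis (t * a j)) *m P.

Lemma torus_subgroup1 P a :
  torus_subgroup P a 1 = P^t* *m diag_mx (\row_j cis (a j)) *m P.
Proof.
rewrite /torus_subgroup; set d := (X in _ *m diag_mx X *m _).
by suff -> : d = \row_j cis (a j) by []; apply/rowP => j; rewrite !mxE mul1r.
Qed.

Lemma torus_one_parameter P a : P \is unitarymx -> one_parameter_subgroup (torus_subgroup P a).
Proof.
move=> uP; have uP' : P^t* \is unitarymx by rewrite trmxC_unitary.
split=> [t|s t].
  refine (mul_unitarymx (mul_unitarymx uP' _) uP); apply/unitarymxP.
  rewrite tr_diag_mx map_diag_mx mulmx_diag -diag_const_mx.
  set d := (X in diag_mx X = _); suff -> : d = const_mx 1 by [].
  by apply/rowP => j; rewrite !mxE cis_conj.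
rewrite /torus_subgroup !mulmxA (mulmxtVK _ uP) -[in RHS](mulmxA (P^t*)) mulmx_diag.
set d := (X in _ *m diag_mx X *m _); set e := (X in _ = _ *m diag_mx X *m _).
suff -> : d = e by [].
by apply/rowP => j; rewrite !mxE mulrDl cisD.
Qed.

Lemma torus_velocity P a : has_velocity (torus_subgroup P a)
  (P^t* *m diag_mx (\row_j (0 +i* a j)) *m P).
Proof.
apply: velocity_mulr; apply: velocity_mull => i j.
change (cvelocity (fun t => diag_mx (\row_j cis (t * a j)) i j) (diag_mx (\row_j (0 +i* a j)) i j)).
rewrite mxE mxE; have [->|ij] := eqVneq i j.
  rewrite (_ : (fun t => _) = fun t => cis (t * a j)); first exact: cvelocity_cis.
  by apply/funext => t; rewrite !mxE eqxx.
rewrite (_ : (fun t => _) = fun=> 0); first exact: cvelocity_cst.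
by apply/funext => t; rewrite !mxE (negPf ij).
Qed.

Lemma diag_imaginary (P : 'M[C]_m) (a : 'I_m -> R)
    (X := P^t* *m diag_mx (\row_j (0 +i* a j)) *m P) : X^t* = - X.
Proof.
rewrite /X !adjmxM trmxCK mulmxA -mulNmx -mulmxN tr_diag_mx map_diag_mx -linearN.
congr (_ *m diag_mx _ *m _); apply/rowP => j; rewrite !mxE.
by apply/eqP; rewrite eq_complex /= oppr0 !eqxx.
Qed.

(** Such X is normal, so the spectral theorem diagonalizes it unitarily, and its eigenvalues are
    imaginary. *)
Lemma skew_one_parameter (X : 'M[C]_m) : X^t* = - X ->
  exists g, one_parameter_subgroup g /\ has_velocity g X.
Proof.
move=> sX; have nX : X \is normalmx by apply/normalmxP; rewrite sX mulmxN mulNmx.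
have /orthomx_spectralP eX := nX.
set P := spectralmx X in eX; have uP : P \is unitarymx := spectral_unitarymx X.
rewrite invmx_unitary // in eX; set d := spectral_diag X in eX.
exists (torus_subgroup P (fun j => complex.Im (d 0 j))).
split; first exact: torus_one_parameter.
have dd : map_mx Num.conj d = - d.
  have ed : diag_mx d = P *m X *m P^t*.
    by rewrite eX !mulmxA (unitarymxP _) // mul1mx mulmxtVK.
  have : (diag_mx d)^t* = - diag_mx d.
    by rewrite ed !adjmxM trmxCK sX mulNmx mulmxN mulmxA.
  by move=> /matrixP e; apply/rowP => j; have := e j j; rewrite !mxE eqxx !mulr1n.
suff ed : d = \row_j (0 +i* complex.Im (d 0 j)).
  by rewrite [X in has_velocity _ X]eX [X in diag_mx X]ed; apply: torus_velocity.
apply/rowP => j; rewrite mxE; move/rowP: dd => /(_ j); rewrite !mxE.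
by case: (d 0 j) => x y /eqP; rewrite eq_complex /= => /andP[/eqP e _]; congr (_ +i* _); lra.
Qed.

(** Surjectivity of the exponential map of U(m): U is unitarily diagonalizable with eigenvalues e^(i
    a_j). This carries invariance from the Lie algebra back to the group. *)
Lemma unitary_one_parameter (U : 'M[C]_m) : U \is unitarymx ->
  exists g X, [/\ one_parameter_subgroup g, has_velocity g X, X^t* = - X & g 1 = U].
Proof.
move=> uU; have nU : U \is normalmx.
  by apply/normalmxP; rewrite (unitarymxP uU) unitarymxKV.
have /orthomx_spectralP eU := nU.
set P := spectralmx U in eU; have uP : P \is unitarymx := spectral_unitarymx U.
rewrite invmx_unitary // in eU; set d := spectral_diag U in eU.
have ed : diag_mx d = P *m U *m P^t*.
  by rewrite eU !mulmxA (unitarymxP _) // mul1mx mulmxtVK.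
have ud : diag_mx d \is unitarymx.
  by rewrite ed; refine (mul_unitarymx (mul_unitarymx uP uU) _); rewrite trmxC_unitary.
have /choice [a da] : forall j, exists t, d 0 j = cis t.
  move=> j; apply: cis_surj; move/unitarymxP/matrixP: ud => /(_ j j).
  by rewrite tr_diag_mx map_diag_mx mulmx_diag !mxE eqxx.
exists (torus_subgroup P a), (P^t* *m diag_mx (\row_j (0 +i* a j)) *m P); split.
- exact: torus_one_parameter.
- exact: torus_velocity.
- exact: diag_imaginary.
- rewrite torus_subgroup1.
  rewrite [RHS]eU.
  suff -> : d = \row_j cis (a j).
    reflexivity.
  by apply/rowP => j; rewrite mxE da.
Qed.

Lemma one_parameter0 (g : R -> 'M[C]_m) : one_parameter_subgroup g -> g 0 = 1%:M.
Proof.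
move=> [ug gD]; have e := gD 0 0; rewrite addr0 in e.
by rewrite -[LHS]mulmx1 -(unitarymxP (ug 0)) mulmxA -e.
Qed.

Lemma one_parameterN (g : R -> 'M[C]_m) t : one_parameter_subgroup g -> g (- t) = (g t)^t*.
Proof.
move=> hg; have [ug gD] := hg; have e := gD (- t) t; rewrite addNr one_parameter0 // in e.
by rewrite -[LHS]mulmx1 -(unitarymxP (ug t)) mulmxA -e mul1mx.
Qed.

End OneParameter.

(** Bundles what [pi] shares with its two tensor products; linearity is a clause here because
    [tens_drep] and [tensc_drep] are plain functions. *)
Definition is_differential {R : realType} {m N : nat} (pi dpi : 'M[R[i]]_m -> 'M[R[i]]_N) : Prop :=
  [/\ forall U, U \is unitarymx -> pi U \is unitarymx,
      forall U V, U \is unitarymx -> V \is unitarymx -> pi (U *m V) = pi U *m pi V,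
      pi 1%:M = 1%:M,
      forall g X, one_parameter_subgroup g -> has_velocity g X ->
        has_velocity (fun t => pi (g t)) (dpi X) &
      forall a X Y, dpi (a *: X + Y) = a *: dpi X + dpi Y].

(** * Properties of the Lie algebra action obtained by differentiating the group action *)

Section Differentiation.
Context {R : realType} {m N : nat}.
Local Notation C := R[i].
Variables (pi : 'M[C]_m -> 'M[C]_N) (dpi : 'M[C]_m -> 'M[C]_N).
Hypothesis diff_pi : is_differential pi dpi.

Let pi_unit U : U \is unitarymx -> pi U \is unitarymx.
Proof. by case: diff_pi => h _ _ _ _; apply: h. Qed.

Let piM U V : U \is unitarymx -> V \is unitarymx -> pi (U *m V) = pi U *m pi V.
Proof. by case: diff_pi => _ h _ _ _; apply: h. Qed.

Let pi1 : pi 1%:M = 1%:M.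
Proof. by case: diff_pi. Qed.

Let dpi_velocity g X : one_parameter_subgroup g -> has_velocity g X ->
  has_velocity (fun t => pi (g t)) (dpi X).
Proof. by case: diff_pi => _ _ _ h _; apply: h. Qed.

Let dpi_linear a X Y : dpi (a *: X + Y) = a *: dpi X + dpi Y.
Proof. by case: diff_pi. Qed.

Lemma dpiD X Y : dpi (X + Y) = dpi X + dpi Y.
Proof. by rewrite -[X]scale1r dpi_linear !scale1r. Qed.

Lemma dpi0 : dpi 0 = 0.
Proof. by apply: (addrI (dpi 0)); rewrite -dpiD !addr0. Qed.

Lemma dpiZ a X : dpi (a *: X) = a *: dpi X.
Proof. by rewrite -[X in dpi X]addr0 dpi_linear dpi0 addr0. Qed.

Lemma dpiN X : dpi (- X) = - dpi X.
Proof. by rewrite -scaleN1r dpiZ scaleN1r. Qed.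

Lemma pi_adj U : U \is unitarymx -> pi (U^t*) = (pi U)^t*.
Proof.
move=> uU; have uV : U^t* \is unitarymx by rewrite trmxC_unitary.
rewrite -[LHS]mulmx1 -(unitarymxP (pi_unit uU)) mulmxA -piM //.
by rewrite (unitarymxKV uU) pi1 mul1mx.
Qed.

(** The two sides are the velocities of pi(g(t))^* and pi(g(-t)), which are the same curve. *)
Lemma dpi_skew X : X^t* = - X -> (dpi X)^t* = - dpi X.
Proof.
move=> sX; have [g [hg vg]] := skew_one_parameter sX.
apply: (velocity_uniq (velocity_adj (dpi_velocity hg vg))).
have := velocity_opp (dpi_velocity hg vg).
rewrite (_ : (fun t => pi (g (- t))) = fun t => (pi (g t))^t*) //.
by apply/funext => t; rewrite (one_parameterN _ hg) (pi_adj (hg.1 t)).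
Qed.

(* The real part of a matrix is [i] times a skew-Hermitian one. *)
Lemma skew_ind (Q : 'M[C]_m -> Prop) : (forall X, X^t* = - X -> Q X) ->
  (forall a X Y, Q X -> Q Y -> Q (a *: X + Y)) -> forall X, Q X.
Proof.
move=> Qs Ql X; have i2 : (Num.imaginary : C) * Num.imaginary = -1 by rewrite -expr2 sqrCi.
have -> : X = Num.imaginary *: ((- Num.imaginary / 2) *: (X + X^t*)) + 2^-1 *: (X - X^t*).
  rewrite scalerA mulrA mulrN i2 opprK mul1r -scalerDr addrACA subrr addr0.
  have -> : X + X = 2 *: X by rewrite scaler_nat mulr2n.
  by rewrite scalerA mulVf ?pnatr_eq0 // scale1r.
apply: Ql; apply: Qs.
- rewrite adjmxZ adjmxD trmxCK addrC -scaleNr; congr (_ *: _).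
  by rewrite rmorphM rmorphN /= conjCi opprK fmorphV rmorph_nat mulNr opprK.
- by rewrite adjmxZ adjmxB trmxCK fmorphV rmorph_nat -scalerN opprB.
Qed.

Lemma dpi_adj X : (dpi X)^t* = dpi (X^t*).
Proof.
elim/skew_ind: X => [X sX|a X Y hX hY]; first by rewrite dpi_skew // sX dpiN.
by rewrite dpi_linear !adjmxD !adjmxZ hX hY dpi_linear.
Qed.

(** For skew-Hermitian X, the curve U g(t) U^* is a one-parameter subgroup with velocity U X U^*;
    general X follow by linearity. *)
Lemma dpi_conj U X : U \is unitarymx ->
  pi U *m dpi X *m (pi U)^t* = dpi (U *m X *m U^t*).
Proof.
move=> uU; elim/skew_ind: X => [X sX|a X Y hX hY]; last first.
  rewrite dpi_linear !mulmxDr !mulmxDl -!scalemxAr -!scalemxAl hX hY.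
  by rewrite dpi_linear.
have [g [hg vg]] := skew_one_parameter sX; have [ug gD] := hg.
have uV : U^t* \is unitarymx by rewrite trmxC_unitary.
have v1 : has_velocity (fun t => U *m g t *m U^t*) (U *m X *m U^t*).
  by apply: velocity_mulr; apply: velocity_mull.
have hg' : one_parameter_subgroup (fun t => U *m g t *m U^t*).
  split=> [t|s t]; first exact: (mul_unitarymx (mul_unitarymx uU (ug t)) uV).
  by rewrite gD !mulmxA -(mulmxA _ (U^t*) U) (unitarymxKV uU) mulmx1.
apply: (velocity_uniq _ (dpi_velocity hg' v1)).
rewrite (_ : (fun t => _) = fun t => pi U *m pi (g t) *m (pi U)^t*).
  by apply: velocity_mulr; apply: velocity_mull; apply: dpi_velocity.
apply/funext => t.
by rewrite (piM (mul_unitarymx uU (ug t)) uV) (piM uU (ug t)) (pi_adj uU).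
Qed.

(** For skew-Hermitian X, differentiate the identity [dpi_conj] for Y at t = 0 along the
    one-parameter subgroup with velocity X. *)
Lemma dpi_bracket X Y : dpi X *m dpi Y - dpi Y *m dpi X = dpi (X *m Y - Y *m X).
Proof.
elim/skew_ind: X => [X sX|a X X' hX hX']; last first.
  rewrite dpi_linear mulmxDl mulmxDr opprD addrACA -scalemxAl -scalemxAr -scalerBr hX hX'.
  rewrite -dpi_linear scalerBr addrACA -opprD; congr dpi.
  by rewrite scalemxAl scalemxAr -mulmxDl -mulmxDr.
have [g [hg vg]] := skew_one_parameter sX; have [ug gD] := hg.
have g0 := one_parameter0 hg; have v := dpi_velocity hg vg.
have vl := velocityM (velocity_mulr (dpi Y) v) (velocity_opp v).
have vr := velocity_linear dpi_linear (velocityM (velocity_mulr Y vg) (velocity_opp vg)).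
rewrite oppr0 g0 !mulmx1 !mul1mx mulmxN in vr.
rewrite oppr0 g0 pi1 !mulmx1 !mul1mx mulmxN in vl.
apply: (velocity_uniq vl); move: vr; congr has_velocity.
by apply/funext => t; rewrite (one_parameterN _ hg) (pi_adj (ug t)) (dpi_conj _ (ug t)).
Qed.

Lemma dpi_gl : gl_relations (fun k l => dpi (delta_mx k l)).
Proof.
move=> a b c d; rewrite -[_ * _]/(_ *m _) -[dpi (delta_mx c d) * _]/(_ *m _) dpi_bracket.
rewrite !mul_delta_mx_cond dpiD dpiN.
by congr (_ - _); [case: (b == c)|rewrite eq_sym; case: (a == d)];
   rewrite ?mulr1n ?mulr0n ?mul1r ?mul0r ?dpi0.
Qed.

Lemma dpi_delta_adj k l : (dpi (delta_mx k l))^t* = dpi (delta_mx l k).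
Proof. by rewrite dpi_adj adjmx_delta. Qed.

Lemma stablemx_proj (S A : 'M[C]_N) :
  stablemx S A^T <-> col_proj S *m A *m col_proj S = A *m col_proj S.
Proof.
split=> [SA|h].
  apply: trmx_inj; rewrite !trmx_mul !trmxK mulmxA proj_ortho_id //.
  by rewrite (submx_trans _ SA) // submxMr // (proj_orthoE S).
apply/stablemx_colP => v /col_proj_id e; apply/col_proj_id.
by rewrite -e !mulmxA h.
Qed.

(** With P the projection onto S, one direction differentiates P pi(g(t)) P = pi(g(t)) P. For the
    other, P commutes with dpi X for skew-Hermitian X, so pi(g(-t)) P pi(g(t)) has zero derivative
    and stays equal to P; every unitary matrix is some g(1). *)
Lemma stable_under_gl (S : 'M[C]_N) : stable_under pi S <-> gl_stable dpi S.
Proof.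
set P := col_proj S; split=> [sS k l|sS U uU].
  apply/stablemx_proj; elim/skew_ind: (delta_mx k l) => [X sX|a X Y hX hY]; last first.
    by rewrite dpi_linear mulmxDr !mulmxDl -scalemxAr -!scalemxAl hX hY.
  have [g [hg vg]] := skew_one_parameter sX; have v := dpi_velocity hg vg.
  apply: (velocity_uniq (velocity_mulr P (velocity_mull P v))).
  have := velocity_mulr P v.
  rewrite (_ : (fun t => pi (g t) *m P) = fun t => P *m pi (g t) *m P) //.
  by apply/funext => t; have /stablemx_proj -> := sS (g t) (hg.1 t).
have sX X : stablemx S (dpi X)^T.
  rewrite (matrix_sum_delta X) (big_morph dpi dpiD dpi0) linear_sum.
  apply: (big_ind (fun Z => stablemx S Z)); [exact: stablemx0|by move=> ? ?; apply: stablemxD|].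
  move=> k _; rewrite (big_morph dpi dpiD dpi0) linear_sum.
  apply: (big_ind (fun Z => stablemx S Z)); [exact: stablemx0|by move=> ? ?; apply: stablemxD|].
  move=> l _; rewrite dpiZ linearZ /= -mul_scalar_mx; apply: stablemxM; last exact: sS.
  exact: stablemxC.
have [g [X [hg vg skX <-]]] := unitary_one_parameter uU.
have cP : P *m dpi X = dpi X *m P by apply: col_proj_comm; rewrite ?dpi_adj.
have ug := hg.1; have G0 : pi (g 0) = 1%:M by rewrite one_parameter0.
have GD s t : pi (g (s + t)) = pi (g s) *m pi (g t) by rewrite hg.2 (piM (ug s) (ug t)).
have v := dpi_velocity hg vg.
have vD := velocityM (velocity_mulr P (velocity_opp v)) v.
rewrite oppr0 G0 mulmx1 mul1mx mulNmx cP addNr in vD.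
have := @velocity_const _ _ (fun t => pi (g (- t)) *m P *m pi (g t)).
move=> /(_ _ 1); rewrite oppr0 G0 mulmx1 mul1mx => cst.
apply/stablemx_proj; rewrite -/P.
have {}cst : pi (g 1) *m P = P *m pi (g 1).
  rewrite -[in LHS]cst => [|t]; first by rewrite !mulmxA -GD subrr G0 mul1mx.
  have := velocity_mulr (pi (g t)) (velocity_mull (pi (g (- t))) vD).
  rewrite mulmx0 mul0mx; congr has_velocity; apply/funext => s.
  by rewrite opprD (GD (- t)) (addrC t s) (GD s) !mulmxA.
by rewrite -mulmxA cst mulmxA col_proj_idem.
Qed.

End Differentiation.

(** * Tensor product representations and their differentials *)

Section TensorDifferential.
Context {R : realType} {m n : nat}.
Local Notation C := R[i].
Variables (pi dpi : 'M[C]_m -> 'M[C]_n).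
Hypothesis diff_pi : is_differential pi dpi.

Lemma tensmx11 : (1%:M : 'M[C]_n) *t (1%:M : 'M[C]_m) = 1%:M.
Proof.
apply/matrixP => x y; case: (mxtens_indexP x) => i a; case: (mxtens_indexP y) => j b.
by rewrite tensmxE !mxE (can_eq (@mxtens_indexK n m)) xpair_eqE -natrM mulnb.
Qed.

Lemma tensmx_unitary (A : 'M[C]_n) (B : 'M[C]_m) :
  A \is unitarymx -> B \is unitarymx -> A *t B \is unitarymx.
Proof.
move=> /unitarymxP hA /unitarymxP hB; apply/unitarymxP.
by rewrite trmx_tens map_mxT tensmx_mul hA hB tensmx11.
Qed.

Lemma tensmxDl (A A' : 'M[C]_n) (B : 'M[C]_m) : (A + A') *t B = A *t B + A' *t B.
Proof. by apply/matrixP => i j; rewrite !mxE mulrDl. Qed.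

Lemma tensmxDr (A : 'M[C]_n) (B B' : 'M[C]_m) : A *t (B + B') = A *t B + A *t B'.
Proof. by apply/matrixP => i j; rewrite !mxE mulrDr. Qed.

Lemma tensmxZl a (A : 'M[C]_n) (B : 'M[C]_m) : (a *: A) *t B = a *: (A *t B).
Proof. by apply/matrixP => i j; rewrite !mxE mulrA. Qed.

Lemma tensmxZr a (A : 'M[C]_n) (B : 'M[C]_m) : A *t (a *: B) = a *: (A *t B).
Proof. by apply/matrixP => i j; rewrite !mxE mulrCA. Qed.

Lemma tens_differential : is_differential (tens_rep pi) (tens_drep dpi).
Proof.
have [uP mP oP vP lP] := diff_pi; split.
- by move=> U uU; apply: tensmx_unitary => //; apply: uP.
- by move=> U V uU uV; rewrite /tens_rep (mP _ _ uU uV) tensmx_mul.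
- by rewrite /tens_rep oP tensmx11.
- move=> g X hg vg; have := velocity_tens (vP _ _ hg vg) vg.
  by rewrite (one_parameter0 hg) oP.
- move=> a X Y; rewrite /tens_drep lP !(tensmxDl, tensmxDr, tensmxZl, tensmxZr).
  by rewrite scalerDr addrACA.
Qed.

Lemma velocity_skew (g : R -> 'M[C]_m) X :
  one_parameter_subgroup g -> has_velocity g X -> X^t* = - X.
Proof.
move=> hg vg; apply: (velocity_uniq (velocity_adj vg)).
have := velocity_opp vg; congr has_velocity.
by apply/funext => t; rewrite (one_parameterN _ hg).
Qed.

Lemma tensc_differential : is_differential (tensc_rep pi) (tensc_drep dpi).
Proof.
have [uP mP oP vP lP] := diff_pi; split.
- by move=> U uU; apply: tensmx_unitary; rewrite ?conjC_unitary //; apply: uP.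
- by move=> U V uU uV; rewrite /tensc_rep (mP _ _ uU uV) map_mxM tensmx_mul.
- by rewrite /tensc_rep oP map_mx1 tensmx11.
- move=> g X hg vg.
  (* The velocity of the conjugate curve is conj X, which is - X^T because X is skew-Hermitian; the
     latter form is complex linear in X. *)
  have vc : has_velocity (fun t => map_mx Num.conj (g t)) (- X^T).
    have -> : - X^T = map_mx Num.conj X.
      by rewrite -linearN -(velocity_skew hg vg); apply/matrixP => i j; rewrite !mxE.
    move=> i j; rewrite -/(cvelocity (fun t => (map_mx Num.conj (g t)) i j) _) mxE.
    rewrite (_ : (fun t => _) = fun t => Num.conj (g t i j)); last first.
      by apply/funext => t; rewrite mxE.
    by apply: cvelocity_conj; apply: vg.
  have := velocity_tens (vP _ _ hg vg) vc.
  by rewrite (one_parameter0 hg) oP map_mx1.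
- move=> a X Y; rewrite /tensc_drep lP linearP opprD -scalerN.
  by rewrite !(tensmxDl, tensmxDr, tensmxZl, tensmxZr) scalerDr addrACA.
Qed.

End TensorDifferential.

(** * Decomposition of the tensor products *)

Section TensorEmbeddings.
Context {R : realType} {m n : nat}.
Local Notation C := R[i].

Definition emb (k : 'I_m) : 'M[C]_(n * m, n) := tens_right (delta_mx k 0).

Lemma embE k i a j : emb k (mxtens_index (i, a)) j = ((i == j) && (a == k))%:R.
Proof.
rewrite castmxE /= cast_ord_id.
have -> : cast_ord (esym (muln1 n)) j = mxtens_index (j, ord0 : 'I_1).
  by apply: val_inj; rewrite /= muln1 addn0.
by rewrite tensmxE !mxE eqxx andbT -natrM mulnb.
Qed.

Lemma sum_mxtens_index (V : nmodType) (f : 'I_(n * m) -> V) :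
  \sum_x f x = \sum_i \sum_a f (mxtens_index (i, a)).
Proof.
rewrite pair_big /= (reindex (@mxtens_index n m)) /=; first by apply: eq_bigr => -[].
by exists (@mxtens_unindex n m) => i _; rewrite (mxtens_indexK, mxtens_unindexK).
Qed.

Lemma mulmx_embE p (M : 'M[C]_(p, n * m)) k x j :
  (M *m emb k) x j = M x (mxtens_index (j, k)).
Proof.
rewrite mxE sum_mxtens_index (bigD1 j) //= (bigD1 k) //= embE !eqxx mulr1.
rewrite big1 => [|a ak]; last by rewrite embE eqxx (negPf ak) mulr0.
rewrite big1 ?addr0 // => i ij.
by rewrite big1 // => a _; rewrite embE (negPf ij) mulr0.
Qed.

Lemma emb_adj_mulmxE p (M : 'M[C]_(n * m, p)) k i y :
  ((emb k)^t* *m M) i y = M (mxtens_index (i, k)) y.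
Proof.
have -> : (emb k)^t* *m M = (M^t* *m emb k)^t* by rewrite adjmxM trmxCK.
by rewrite mxE mxE mulmx_embE !mxE conjCK.
Qed.

Lemma emb_mulmxE p (M : 'M[C]_(n, p)) k i a y :
  (emb k *m M) (mxtens_index (i, a)) y = (a == k)%:R * M i y.
Proof.
rewrite mxE (bigD1 i) //= embE eqxx big1 ?addr0 // => b.
by rewrite eq_sym embE => /negPf ->; rewrite mul0r.
Qed.

Lemma emb_orth k l : (emb k)^t* *m emb l = (k == l)%:R%:M.
Proof. by apply/matrixP => i j; rewrite emb_adj_mulmxE embE !mxE; case: (k == l); case: (i == j). Qed.

Lemma emb_complete : \sum_k emb k *m (emb k)^t* = 1%:M.
Proof.
apply/matrixP => x y; rewrite summxE.
case: (mxtens_indexP x) => i a; case: (mxtens_indexP y) => j b.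
rewrite (bigD1 a isT) /= emb_mulmxE eqxx mul1r.
rewrite big1 => [|k].
  rewrite addr0 !mxE embE rmorph_nat; congr (_%:R).
  rewrite (can_eq (@mxtens_indexK n m)) xpair_eqE eq_sym [b == a]eq_sym.
  by [].
by rewrite eq_sym emb_mulmxE => /negPf ->; rewrite mul0r.
Qed.

Lemma emb_adj_tens (X : 'M[C]_n) (Y : 'M[C]_m) j :
  (emb j)^t* *m (X *t Y) = \sum_c Y j c *: (X *m (emb c)^t*).
Proof.
apply/matrixP => i x; case: (mxtens_indexP x) => b c.
rewrite emb_adj_mulmxE tensmxE summxE (bigD1 c) //= big1 => [|d dc].
  rewrite addr0 mxE mxE (bigD1 b) //= big1 => [|b' b'b].
    by rewrite addr0 !mxE embE !eqxx rmorph1 mulr1 mulrC.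
  by rewrite !mxE embE eq_sym (negPf b'b) rmorph0 mulr0.
rewrite mxE mxE big1 ?mulr0 // => b' _.
by rewrite !mxE embE [c == d]eq_sym (negPf dc) andbF rmorph0 mulr0.
Qed.

Lemma emb_adj_tens1 (X : 'M[C]_n) j : (emb j)^t* *m (X *t 1%:M) = X *m (emb j)^t*.
Proof.
rewrite emb_adj_tens (bigD1 j) //= big1 => [|c]; first by rewrite addr0 mxE eqxx scale1r.
by rewrite eq_sym mxE => /negPf ->; rewrite scale0r.
Qed.

Lemma emb_adj_tens_delta j k l :
  (emb j)^t* *m (1%:M *t delta_mx k l) = (k == j)%:R *: (emb l)^t*.
Proof.
rewrite emb_adj_tens (bigD1 l) //= big1 => [|c cl].
  by rewrite addr0 mxE eqxx andbT mul1mx eq_sym.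
by rewrite mxE (negPf cl) andbF scale0r.
Qed.

(** The ring isomorphism from End(V (x) C^m) to the m x m matrices over End V. It turns powers of B
    into powers of a matrix with noncommuting entries. *)
Definition blocks (M : 'M[C]_(n * m)) : 'M['M[C]_n]_m :=
  \matrix_(k, l) ((emb k)^t* *m M *m emb l).

Lemma blocksM M1 M2 : blocks (M1 *m M2) = blocks M1 *m blocks M2.
Proof.
have {1}-> : M1 *m M2 = \sum_j M1 *m (emb j *m (emb j)^t*) *m M2.
  by rewrite -mulmx_suml -mulmx_sumr emb_complete mulmx1.
apply/matrixP => k l; rewrite [LHS]mxE [RHS]mxE mulmx_sumr mulmx_suml.
apply: eq_bigr => j _; rewrite [X in _ = X * _]mxE [X in _ = _ * X]mxE.
by rewrite -[RHS]/(_ *m _) !mulmxA.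
Qed.

Lemma blocks1 : blocks 1%:M = 1%:M.
Proof.
apply/matrixP => k l; rewrite [LHS]mxE [RHS]mxE mulmx1 emb_orth.
by case: (k == l); rewrite ?raddf0.
Qed.

Lemma blocksX M q : blocks (M ^+ q) = blocks M ^+ q.
Proof.
elim: q => [|q IH]; first exact: blocks1.
by rewrite !exprS -IH; exact: blocksM.
Qed.

Lemma blocksD M1 M2 : blocks (M1 + M2) = blocks M1 + blocks M2.
Proof. by apply/matrixP => k l; rewrite !mxE mulmxDr mulmxDl. Qed.

Lemma blocksN M : blocks (- M) = - blocks M.
Proof. by apply/matrixP => k l; rewrite !mxE mulmxN mulNmx. Qed.

Lemma blocks_casimir (F : 'I_m -> 'I_m -> 'M[C]_n) :
  blocks (tensor_casimir F emb) = (\matrix_(k, l) F k l)^T.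
Proof.
apply/matrixP => k l; rewrite !mxE -mulmxA mulmx_suml mulmx_sumr.
rewrite (bigD1 l) //= [X in _ + X]big1 ?addr0 => [|a al]; last first.
  rewrite mulmx_suml mulmx_sumr big1 // => b _.
  by rewrite -!mulmxA emb_orth (negPf al) raddf0 !mulmx0.
rewrite mulmx_suml mulmx_sumr (bigD1 k) //= big1 ?addr0 => [|b].
  by rewrite -!mulmxA emb_orth eqxx mulmx1 mulmxA emb_orth eqxx mul1mx.
by rewrite eq_sym => /negPf kb; rewrite !mulmxA emb_orth kb raddf0 !mul0mx.
Qed.

End TensorEmbeddings.

(** * The constituents as the spectral decomposition of B *)

Section Decomposition.
Context {R : realType} {m n N : nat}.
Local Notation C := R[i].
Variables (F : 'I_m -> 'I_m -> 'M[C]_n) (FT : 'I_m -> 'I_m -> 'M[C]_N).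
Variables (J : 'I_m -> 'M[C]_(N, n)) (r : 'I_m -> nat).
Variables (v0 : 'cV[C]_n) (w : 'I_m -> C).
Hypothesis r_inj : injective r.
Hypothesis glF : gl_relations F.
Hypothesis adjF : forall k l, (F k l)^t* = F l k.
Hypothesis JJ : forall k l, (J k)^t* *m J l = (k == l)%:R%:M.
Hypothesis sumJ : \sum_k J k *m (J k)^t* = 1%:M.
Hypothesis JF : forall j k l,
  (J j)^t* *m FT k l = F k l *m (J j)^t* + (k == j)%:R *: (J l)^t*.
Hypothesis v0_weight : forall k, F k k *m v0 = w k *: v0.
Hypothesis w_real : forall k, Num.conj (w k) = w k.
Hypothesis v0_unique : forall x, singular_for r F x -> exists c, x = c *: v0.

Variables (piT dpiT : 'M[C]_m -> 'M[C]_N) (lam : 'I_m -> 'rV[int]_m).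
Local Notation E k l := (dpiT (delta_mx k l)).
Hypothesis stableT : forall S : 'M[C]_N, stable_under piT S <-> gl_stable dpiT S.
Hypothesis glT : gl_relations (fun k l => E k l).
Hypothesis adjT : forall k l, (E k l)^t* = E l k.
Hypothesis singularT : forall v, singular dpiT v <-> singular_for r FT v.
Hypothesis weightT : forall i v, has_weight dpiT (lam i) v <-> tensor_weight FT w i v.
Hypothesis E_FT : forall k l, exists s k' l', E k l = s *: FT k' l'.
Hypothesis FT_E : forall k, exists s, FT k k = s *: E k k.

Local Notation Cas := (tensor_casimir F J).
Let beta i : C := w i - (\sum_(a | (r a < r i)%N) 1)%:R.
Hypothesis beta_inj : injective beta.
Local Notation S i := (constituent piT dpiT (lam i)).
Local Notation P i := (col_proj (S i)).

Lemma irreducible_gl (T : 'M[C]_N) : irreducible_subrep piT T <-> gl_irreducible dpiT T.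
Proof.
split=> -[T0 stT irr]; split=> //; try exact/stableT.
  by move=> U /stableT stU; apply: irr.
by move=> U /stableT stU; apply: irr.
Qed.

Lemma constituent_cases i :
  S i = 0 \/ gl_irreducible dpiT (S i) /\ is_highest_weight dpiT (S i) (lam i).
Proof.
rewrite /constituent; case: dominant; last by left.
case: xgetP => [T _ [/irreducible_gl irrT hT]|_]; first by right.
by left.
Qed.

Lemma constituent_exists i T : dominant (lam i) -> gl_irreducible dpiT T ->
  is_highest_weight dpiT T (lam i) ->
  gl_irreducible dpiT (S i) /\ is_highest_weight dpiT (S i) (lam i).
Proof.
move=> dom irrT hT; rewrite /constituent dom; case: xgetP => [U _ [/irreducible_gl]//|].
by move/(_ T); case; split=> //; apply/irreducible_gl.
Qed.

Lemma stable_constituent i : gl_stable dpiT (S i).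
Proof.
case: (constituent_cases i) => [->|[[]//]] k l.
exact: stable0mx.
Qed.

Lemma constituent_comm i k l : P i *m E k l = E k l *m P i.
Proof. by apply: col_proj_comm; rewrite ?adjT; apply: stable_constituent. Qed.

Lemma casimir_E k l (v : 'cV[C]_N) : E k l *m (Cas *m v) = Cas *m (E k l *m v).
Proof.
have [s [k' [l' ->]]] := E_FT k l.
by rewrite -!scalemxAl -scalemxAr (casimir_comm glF JJ sumJ JF).
Qed.

Lemma casimir_adj : Cas^t* = Cas.
Proof.
rewrite [RHS]exchange_big adjmx_sum; apply: eq_bigr => b _.
rewrite adjmx_sum; apply: eq_bigr => a _.
by rewrite !adjmxM trmxCK adjF mulmxA.
Qed.

Lemma constituent_singular i : S i != 0 ->
  exists v, [/\ v != 0, (v^T <= S i)%MS, singular dpiT v & has_weight dpiT (lam i) v].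
Proof.
case: (constituent_cases i) => [->|[[_ stS _] hS] _]; first by rewrite eqxx.
exact: (highest_singular glT stS hS).
Qed.

(** The vectors of S_i on which B acts by beta_i form a submodule, because B commutes with the
    action. It contains the singular vector of S_i, so by irreducibility it is all of S_i. *)
Lemma casimir_constituent i : Cas *m P i = beta i *: P i.
Proof.
have [S0|S0] := eqVneq (S i) 0; first by rewrite S0 col_proj0 mulmx0 scaler0.
have [v [nv vS sv wv]] := constituent_singular S0.
case: (constituent_cases i) => [e|[[_ stS irrS] _]]; first by rewrite e eqxx in S0.
have ev : Cas *m v = beta i *: v.
  apply: (tensor_casimir_singular r_inj glF JJ sumJ JF v0_weight v0_unique).
    exact/singularT.
  exact/weightT.
have [||T hT] := @mx_of_subspace R N (fun x => (x^T <= S i)%MS /\ Cas *m x = beta i *: x).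
- by rewrite trmx0 sub0mx mulmx0 scaler0.
- move=> b x y [xS ex] [yS ey]; split.
    by rewrite linearP addmx_sub // scalemx_sub.
  by rewrite mulmxDr -scalemxAr ex ey scalerDr !scalerA mulrC.
have stT : gl_stable dpiT T.
  move=> k l; apply/stablemx_colP => x /hT[xS ex]; apply/hT; split.
    by move/stablemx_colP: (stS k l); apply.
  by rewrite -casimir_E ex scalemxAr.
have TS : (T <= S i)%MS by apply: submx_col_ext => x /hT[].
case: (irrS T stT TS) => [T0|ST].
  have /hT : (v^T <= S i)%MS /\ Cas *m v = beta i *: v by [].
  by rewrite T0 submx0 trmx_eq0 (negPf nv).
apply: mulmx_col_ext => x; rewrite -mulmxA -scalemxAl.
by have /hT[] : ((P i *m x)^T <= T)%MS by apply: submx_trans ST; apply: col_proj_sub.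
Qed.

(** Eigenspaces of the Hermitian operator B for the distinct real eigenvalues beta_i and beta_j. *)
Lemma constituent_orth i j : i != j -> P i *m P j = 0.
Proof.
move=> ij; have Pi_cas : P i *m Cas = beta i *: P i.
  by rewrite -[LHS]trmxCK adjmxM casimir_adj col_proj_adj casimir_constituent
    adjmxZ col_proj_adj rmorphB /= w_real rmorph_nat.
have /eqP : beta i *: (P i *m P j) = beta j *: (P i *m P j).
  by rewrite scalemxAl -Pi_cas -mulmxA casimir_constituent scalemxAr.
rewrite -subr_eq0 -scalerBl scaler_eq0 subr_eq0 (inj_eq beta_inj) (negPf ij) /=.
by move/eqP.
Qed.

(** If not, the common kernel T of the P_i is a nonzero submodule and contains an irreducible T1,
    which has a singular vector x of some weight lam_i. That weight is dominant and highest in T1,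
    so S_i is nonzero and has a singular vector of the same weight. By uniqueness x lies in S_i,
    contradicting P_i x = 0. *)
Lemma constituent_complete : \sum_i P i = 1%:M.
Proof.
set Q := 1%:M - \sum_i P i; apply/esym/eqP; rewrite -subr_eq0 -/Q; apply: contraT => Q0.
have PQ i : P i *m Q = 0.
  rewrite mulmxBr mulmx1 mulmx_sumr (bigD1 i isT) /= col_proj_idem.
  by rewrite big1 ?addr0 ?subrr // => j ji; rewrite constituent_orth // eq_sym.
have [||T hT] := @mx_of_subspace R N (fun x => forall i, P i *m x = 0).
- by move=> i; rewrite mulmx0.
- by move=> b x y hx hy i; rewrite mulmxDr -scalemxAr hx hy scaler0 addr0.
have stT : gl_stable dpiT T.
  move=> k l; apply/stablemx_colP => x /hT hx; apply/hT => i.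
  by rewrite mulmxA constituent_comm -mulmxA hx mulmx0.
have T0 : T != 0.
  apply: contra Q0 => /eqP T0; apply/eqP; apply: mulmx_col_ext => x.
  have : ((Q *m x)^T <= T)%MS by apply/hT => i; rewrite mulmxA PQ mul0mx.
  by rewrite T0 submx0 trmx_eq0 mul0mx => /eqP.
have [T1 [irr1 T1T]] := exists_irreducible T0 stT.
have [T10 st1 _] := irr1.
have [v [nv vT sv]] := exists_singular glT T10 st1.
have [|k x [xT sx]|x [_ sx]||//|i [x [nx [xT sx] wx]]] :=
  @tensor_singular_exists R m n N F FT J r v0 w r_inj sumJ JF v0_weight v0_unique
    (fun x => (x^T <= T1)%MS /\ singular dpiT x) v.
- move=> b x y [xT sx] [yT sy]; split.
    by rewrite linearP addmx_sub // scalemx_sub.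
  by move=> k l kl; rewrite mulmxDr -scalemxAr sx // sy // scaler0 addr0.
- have [s ->] := FT_E k; rewrite -scalemxAl; split.
    by rewrite linearZ scalemx_sub //; move/stablemx_colP: (st1 k k); apply.
  by move=> a b ab; rewrite -scalemxAr (singular_diag glT _ sx) // scaler0.
- exact/singularT.
- by [].
have wx' : has_weight dpiT (lam i) x by apply/weightT.
have h1 := singular_highest glT adjT irr1 nx xT sx wx'.
have dom := singular_dominant glT adjT nx sx wx'.
have [[Si0 _ _] _] := constituent_exists dom irr1 h1.
have [y [ny yS sy wy]] := constituent_singular Si0.
have [c ec] : exists c, x = c *: y.
  apply: (tensor_singular_unique (r := r) sumJ JF v0_weight v0_unique ny _ _ _ wx).
  - exact/singularT.
  - exact/weightT.
  - exact/singularT.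
have /hT/(_ i) := submx_trans xT T1T.
move: yS => /col_proj_id Py.
by rewrite ec -scalemxAr Py -ec => /eqP; rewrite (negPf nx).
Qed.

Lemma shifted_casimir_constituents s q :
  (- Cas - s%:M) ^+ q = \sum_i (- beta i - s) ^+ q *: P i.
Proof.
elim: q => [|q IH].
  by under eq_bigr do rewrite expr0 scale1r; rewrite constituent_complete.
rewrite exprS IH mulr_sumr; apply: eq_bigr => i _.
rewrite -[LHS]/(_ *m _) -scalemxAr mulmxBl mulNmx casimir_constituent mul_scalar_mx.
by rewrite -scaleNr -scalerBl scalerA exprSr.
Qed.

End Decomposition.

(** * The two conformal identities *)

Section Kpolynomials.
Context {R : realType} {m n : nat}.
Local Notation C := R[i].

Lemma sign_mulmx q (M : 'M[C]_n) : (-1) ^+ q * M = (-1) ^+ q *: M.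
Proof.
elim: q M => [|q IH] M; first by rewrite !expr0 mul1r scale1r.
by rewrite !exprS -mulrA mulN1r IH mulN1r scaleNr.
Qed.

Lemma scalar_mxX (a : C) k : (a%:M : 'M[C]_n) ^+ k = (a ^+ k)%:M.
Proof.
elim: k => [|k IH]; first by rewrite !expr0.
by rewrite !exprS IH scalar_mxM.
Qed.

(** Casimir elements act by scalars, which reduces K_n to a numerical polynomial obeying the
    recursion above. *)
Lemma Kpoly_scalar (c : nat -> 'M[C]_n) (g : nat -> C) N :
  (forall p, c p = (g p)%:M) -> Kpoly c N = (Kscal g N N)%:M.
Proof.
move=> cg; rewrite /Kpoly /Kscal (big_morph _ (@raddfD _ _ (@scalar_mx C n)) (raddf0 _)).
apply: eq_bigr => f _; apply: etrans (scale_scalar_mx _ _ _); rewrite -/(multicoef C f).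
apply: congr1.
rewrite (big_morph (@scalar_mx C n) (@scalar_mxM C n) (erefl _)).
by apply: eq_bigr => j _; rewrite cg scalar_mxX.
Qed.

(* [X i a b] and [Y i a b] stand for [p_i(e_a)^* p_i(e_b)] in the two tensor products. *)
Lemma conformal_identity (A : 'M['M[C]_n]_m) (c : nat -> 'M[C]_n) (g : nat -> C)
    (w1 w2 : 'I_m -> C) (X Y : 'I_m -> 'I_m -> 'I_m -> 'M[C]_n) q k l :
  gl_relations A -> (forall p, c p = \tr (A ^+ p)) -> (forall p, c p = (g p)%:M) ->
  (forall a b, \sum_i (w1 i - m%:R) ^+ q *: X i a b = ((- A^T - m%:R) ^+ q) a b) ->
  (forall p a b, \sum_i w2 i ^+ p *: Y i a b = (A ^+ p) a b) ->
  \sum_i (w1 i - m%:R) ^+ q *: X i k l = (-1) ^+ q *: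
    \sum_i (\sum_(p < q.+1) w2 i ^+ p *: Kpoly c (q - p)) *m Y i l k.
Proof.
move=> glA cA cg hX hY; rewrite hX -opprD.
rewrite mx_expN sign_mulmx.
congr (_ *: _).
(* The sign has been pulled out of (- A^T - m)^q. The values of K_n are scalars, hence central, and
   [Kscal_diag_rec] is the required convolution with c_j = tr A^j. *)
rewrite (shifted_trmx_pow glA (kap := fun p => Kpoly c p)).
- under [RHS]eq_bigr do rewrite mulmx_suml.
  rewrite exchange_big; apply: eq_bigr => p _.
  rewrite -hY mulr_sumr; apply: eq_bigr => i _.
  by rewrite -[LHS]/(_ *m _) -scalemxAr -scalemxAl.
- by move=> a b p; rewrite (Kpoly_scalar _ cg); apply: scalar_mxC.
- by rewrite (Kpoly_scalar _ cg) Kscal0.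
- move=> N; rewrite (Kpoly_scalar _ cg) Kscal_diag_rec.
  rewrite (big_morph _ (@raddfD _ _ (@scalar_mx C n)) (raddf0 _)).
  apply: eq_bigr => j _; rewrite -cA cg (Kpoly_scalar _ cg) mulrC.
  exact: scalar_mxM.
Qed.

Lemma casimir_trace (dpi : 'M[C]_m -> 'M[C]_n) p :
  casimir dpi p = \tr ((\matrix_(k, l) dpi (delta_mx k l) : 'M['M[C]_n]_m) ^+ p).
Proof.
case: p => [|p]; first by rewrite expr0 mxtrace1.
rewrite -trace_pow_cycles; apply: eq_bigr => s _; apply: eq_bigr => j _.
by rewrite mxE.
Qed.

(** The sign (-1)^p is distributed over the p factors, one minus sign for each entry - E_lk. *)
Lemma casimirc_trace (dpi : 'M[C]_m -> 'M[C]_n) p :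
  casimirc dpi p = \tr ((\matrix_(k, l) - dpi (delta_mx l k) : 'M['M[C]_n]_m) ^+ p).
Proof.
case: p => [|p]; first by rewrite expr0 mxtrace1.
rewrite -trace_pow_cycles [LHS]scaler_sumr; apply: eq_bigr => s _.
under [RHS]eq_bigr do rewrite mxE.
by rewrite prodrN card_ord sign_mulmx.
Qed.

Lemma sum1_ord_lt (i : 'I_m) : (\sum_(a < m | (a < i)%N) 1)%N = i.
Proof.
rewrite -(big_ord_widen m (fun=> 1%N)) ?sum_nat_const ?card_ord ?muln1 //.
exact: ltnW.
Qed.

Lemma sum1_ord_gt (i : 'I_m) : (\sum_(a < m | (m - a < m - i)%N) 1)%N = (m - i.+1)%N.
Proof.
rewrite -[RHS](sum1_ord_lt (rev_ord i)) (reindex_inj rev_ord_inj).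
by apply: eq_bigl => a /=; have := ltn_ord a; have := ltn_ord i; lia.
Qed.

End Kpolynomials.

(** * Products of Clifford homomorphisms as blocks of polynomials in B *)

Section Clifford.
Context {R : realType} {m n : nat}.
Local Notation C := R[i].
Variables (pi dpi : 'M[C]_m -> 'M[C]_n) (rho : 'rV[int]_m).
Hypothesis diff_pi : is_differential pi dpi.
Hypothesis irr_pi : irreducible_subrep pi 1%:M.
Hypothesis rho_highest : is_highest_weight dpi 1%:M rho.
Local Notation E k l := (dpi (delta_mx k l)).
Local Notation eps a := (delta_mx a 0).

Let glE : gl_relations (fun k l => E k l) := dpi_gl diff_pi.
Let adjE k l : (E k l)^t* = E l k := dpi_delta_adj diff_pi k l.

Let irrE : gl_irreducible dpi 1%:M.
Proof. by apply/(irreducible_gl (stable_under_gl diff_pi)). Qed.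

Definition gl_entries : 'M['M[C]_n]_m := \matrix_(k, l) E k l.
Definition gl_dual_entries : 'M['M[C]_n]_m := \matrix_(k, l) - E l k.

Lemma gl_entries_relations : gl_relations gl_entries.
Proof. by move=> a b c d; rewrite !mxE; apply: glE. Qed.

(** The map X |-> - X^T is an automorphism of gl_m. *)
Lemma dual_relations : gl_relations (fun k l => - E l k).
Proof.
by move=> a b c d; rewrite !mulrNN glE !mulrN opprK addrC.
Qed.

Lemma gl_dual_entries_relations : gl_relations gl_dual_entries.
Proof. by move=> a b c d; rewrite !mxE; apply: dual_relations. Qed.

Lemma gl_dual_entriesE : gl_dual_entries = - gl_entries^T.
Proof. by apply/matrixP => k l; rewrite !mxE. Qed.

Lemma central_scalar (X : 'M[C]_n) : (forall k l, X *m E k l = E k l *m X) ->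
  exists a, X = a%:M.
Proof.
move=> cX; have [|a ha] := gl_schur irrE _ cX; first exact: submx1.
by exists a; apply: mulmx_col_ext => v; rewrite mul_scalar_mx ha // submx1.
Qed.

Lemma trace_pow_scalar p : exists a, \tr (gl_entries ^+ p) = a%:M.
Proof.
apply: central_scalar => k l.
by have := trace_pow_central gl_entries_relations p k l; rewrite mxE.
Qed.

Lemma trace_dual_pow_scalar p : exists a, \tr (gl_dual_entries ^+ p) = a%:M.
Proof.
apply: central_scalar => k l.
have := trace_pow_central gl_dual_entries_relations p l k.
by rewrite mxE mulNr mulrN => /oppr_inj.
Qed.

Lemma highest_vector : exists v, [/\ v != 0, forall k, E k k *m v = (rho 0 k)%:~R *: v &
  forall x, singular dpi x -> exists c, x = c *: v].
Proof.
have [_ stE _] := irrE.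
have [v [nv vS sv wv]] := highest_singular glE stE rho_highest.
exists v; split=> // x sx; apply: singular_unique irrE nv vS sv wv _ sx => //.
exact: submx1.
Qed.

Lemma rho_nonincreasing (i j : 'I_m) : (i <= j)%N -> rho 0 j <= rho 0 i.
Proof.
have [_ stE _] := irrE.
have [v [nv _ sv wv]] := highest_singular glE stE rho_highest.
by have /forallP/(_ i)/forallP/(_ j)/implyP := singular_dominant glE adjE nv sv wv.
Qed.

(** As [rho] is nonincreasing, w_+ is strictly increasing in i; likewise w_- is strictly
    decreasing. *)
Lemma wplus_inj : injective (wplus rho).
Proof.
move=> i j; rewrite /wplus => e; apply: ord_inj.
by have [ij|ij|//] := ltngtP i j; have := rho_nonincreasing (ltnW ij); lia.
Qed.

Lemma wminus_inj : injective (wminus rho).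
Proof.
move=> i j; rewrite /wminus => e; apply: ord_inj.
by have [ij|ij|//] := ltngtP i j; have := rho_nonincreasing (ltnW ij); lia.
Qed.

Lemma adj_col_proj_emb (N : nat) (S : 'M[C]_N) (J K : 'M[C]_(N, n)) :
  (col_proj S *m J)^t* *m (col_proj S *m K) = J^t* *m col_proj S *m K.
Proof. by rewrite adjmxM col_proj_adj !mulmxA -(mulmxA (J^t*) (col_proj S) (col_proj S)) col_proj_idem. Qed.

Lemma blocks_sum (I : finType) (a : I -> C) (P : I -> 'M[C]_(n * m)) k l :
  blocks (\sum_i a i *: P i) k l = \sum_i a i *: ((emb k)^t* *m P i *m emb l).
Proof.
rewrite mxE mulmx_sumr mulmx_suml; apply: eq_bigr => i _.
by rewrite -scalemxAr -scalemxAl.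
Qed.

Lemma blocks_nat : blocks (m%:R%:M : 'M[C]_(n * m)) = m%:R.
Proof.
apply/matrixP => k l; rewrite mxE mul_mx_scalar -scalemxAl emb_orth.
rewrite -[m%:R : 'M['M[C]_n]_m]/(1 *+ m) mulmxnE mxE scaler_nat.
by case: (k == l); rewrite ?raddf0 ?mul0rn.
Qed.

(** The product p_{+i}(eps_k)^* p_{+i}(eps_l) is the (k, l) block of the projection P_i, so the sum
    is a block of the spectral expansion of (- B - s)^q. *)
Lemma plus_blocks s q k l :
  \sum_i ((wplus rho i)%:~R - s) ^+ q *:
    ((clifford_plus pi dpi rho i (eps k))^t* *m clifford_plus pi dpi rho i (eps l))
  = blocks ((- tensor_casimir (fun a b => E a b) emb - s%:M) ^+ q) k l.
Proof.
have [v [nv wv uv]] := highest_vector; have diffT := tens_differential diff_pi.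
pose r (a : 'I_m) := nat_of_ord a.
(* There are i indices below i, counted from 0, so - beta_i is w_{+i}. *)
have eb i : - ((rho 0 i)%:~R - (\sum_(a | (r a < r i)%N) 1)%:R) = (wplus rho i)%:~R :> C.
  by rewrite sum1_ord_lt opprB addrC rmorphD rmorphN.
rewrite (@shifted_casimir_constituents R m n _ (fun a b => E a b)
  (fun k l => tens_drep dpi (delta_mx k l)) emb r v (fun k => (rho 0 k)%:~R)
  (@ord_inj m) glE adjE emb_orth emb_complete _ wv _ _
  (tens_rep pi) (tens_drep dpi) (fun i => rho + delta_mx 0 i)
  (stable_under_gl diffT) (dpi_gl diffT) (dpi_delta_adj diffT)).
- rewrite blocks_sum; apply: eq_bigr => i _.
  by rewrite adj_col_proj_emb eb.
- move=> j a b; rewrite mulmxDr emb_adj_tens1.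
  by rewrite emb_adj_tens_delta.
- by move=> a; rewrite rmorph_int.
- by [].
- by [].
- move=> i x; split=> h a; rewrite h !mxE eqxx rmorphD /= rmorph_nat //.
- by move=> a b; exists 1, a, b; rewrite scale1r.
- by move=> a; exists 1; rewrite scale1r.
- move=> i j /eqP; rewrite -eqr_opp !eb eqr_int => /eqP; exact: wplus_inj.
Qed.

Lemma minus_blocks s q k l :
  \sum_i ((wminus rho i)%:~R - s) ^+ q *:
    ((clifford_minus pi dpi rho i (eps k))^t* *m clifford_minus pi dpi rho i (eps l))
  = blocks ((- tensor_casimir (fun a b => - E b a) emb - s%:M) ^+ q) k l.
Proof.
have [v [nv wv uv]] := highest_vector; have diffT := tensc_differential diff_pi.
(* The order is reversed, as the operators - E_ba raise for b < a. *)
pose r (a : 'I_m) := (m - a)%N.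
have r_inj : injective r.
  move=> a b; rewrite /r => e; apply: ord_inj.
  by have := ltn_ord a; have := ltn_ord b; lia.
have rE (a b : 'I_m) : (r a < r b)%N = (b < a)%N.
  by rewrite /r; have := ltn_ord a; have := ltn_ord b; lia.
(* Here the count is that of the m - i - 1 indices after i, which gives w_{-i}. *)
have eb i : - (- (rho 0 i)%:~R - (\sum_(a | (r a < r i)%N) 1)%:R) = (wminus rho i)%:~R :> C.
  rewrite sum1_ord_gt opprB opprK addrC natrB; last exact: ltn_ord.
  by rewrite /wminus -addrA rmorphD rmorphB /= .
rewrite (@shifted_casimir_constituents R m n _ (fun a b => - E b a)
  (fun k l => - tensc_drep dpi (delta_mx l k)) emb r v (fun k => - (rho 0 k)%:~R)
  r_inj dual_relations _ emb_orth emb_complete _ _ _ _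
  (tensc_rep pi) (tensc_drep dpi) (fun i => rho - delta_mx 0 i)
  (stable_under_gl diffT) (dpi_gl diffT) (dpi_delta_adj diffT)).
- rewrite blocks_sum; apply: eq_bigr => i _.
  by rewrite adj_col_proj_emb eb.
- by move=> a b; rewrite adjmxN adjE.
- move=> j a b.
  have -> : tensc_drep dpi (delta_mx b a) = E b a *t 1%:M - 1%:M *t delta_mx a b.
    by rewrite /tensc_drep trmx_delta; apply/matrixP => x y; rewrite !mxE mulrN.
  by rewrite mulmxN mulmxBr emb_adj_tens1 emb_adj_tens_delta opprB addrC mulNmx.
- by move=> a; rewrite mulNmx wv scaleNr.
- by move=> a; rewrite rmorphN rmorph_int.
- move=> x sx; apply: uv => a b ab; apply: oppr_inj.
  by rewrite -mulNmx oppr0; apply: sx; rewrite rE.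
- move=> x; split=> sx a b ab; last first.
    by apply: oppr_inj; rewrite -mulNmx oppr0; apply: sx; rewrite rE.
  by rewrite mulNmx sx ?oppr0 // -rE.
- move=> i x.
  have ew a : - ((rho - delta_mx 0 i) 0 a)%:~R = - (rho 0 a)%:~R + (a == i)%:R :> C.
    by rewrite !mxE eqxx rmorphB /= rmorph_nat opprB addrC.
  split=> h a; first by rewrite mulNmx h -ew scaleNr.
  by apply: oppr_inj; rewrite -mulNmx -scaleNr ew; apply: h.
- by move=> a b; exists (-1), b, a; rewrite scaleN1r opprK.
- by move=> a; exists (-1); rewrite scaleN1r.
- move=> i j /eqP; rewrite -eqr_opp !eb eqr_int => /eqP; exact: wminus_inj.
Qed.

End Clifford.

Theorem corollary5p5 (R : realType) (m n : nat) (m_ge1 : (1 <= m)%N)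
    (rho : 'rV[int]_m)
    (pi : 'M[R[i]]_m -> 'M[R[i]]_n) (dpi : {linear 'M[R[i]]_m -> 'M[R[i]]_n})
    (pi_unitary : is_unitary_rep pi)
    (dpi_induced : is_induced_rep pi dpi)
    (pi_irreducible : irreducible_subrep pi 1%:M)
    (rho_highest : is_highest_weight dpi 1%:M rho)
    (q : nat) (k l : 'I_m) :
  let eps (a : 'I_m) : 'cV[R[i]]_m := delta_mx a 0 in
  let p_plus i a := clifford_plus pi dpi rho i (eps a) in
  let p_minus i a := clifford_minus pi dpi rho i (eps a) in
  let w_plus i : R[i] := (wplus rho i)%:~R in
  let w_minus i : R[i] := (wminus rho i)%:~R in
  \sum_(i < m) (w_plus i - m%:R) ^+ q *: ((p_plus i k)^t* *m p_plus i l)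
    = (-1) ^+ q *:
      \sum_(i < m)
        (\sum_(p < q.+1) w_minus i ^+ p *: Kpoly (casimir dpi) (q - p))
          *m ((p_minus i l)^t* *m p_minus i k)
  /\
  \sum_(i < m) (w_minus i - m%:R) ^+ q *: ((p_minus i k)^t* *m p_minus i l)
    = (-1) ^+ q *:
      \sum_(i < m)
        (\sum_(p < q.+1) w_plus i ^+ p *: Kpoly (casimirc dpi) (q - p))
          *m ((p_plus i l)^t* *m p_plus i k).
Proof.
move=> eps p_plus p_minus w_plus w_minus.
have diff : is_differential pi dpi.
  by case: pi_unitary => uP mP oP _; split=> // a X Y; rewrite linearP.
pose A := gl_entries dpi; pose A' := gl_dual_entries dpi.
have AT : A' = - A^T := gl_dual_entriesE dpi.
have A'T : A = - A'^T by apply/matrixP => a b; rewrite !mxE opprK.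
have cas_plus : blocks (- tensor_casimir (fun a b => dpi (delta_mx a b)) emb) = A'.
  by rewrite blocksN blocks_casimir -/(gl_entries dpi) -AT.
have cas_minus : blocks (- tensor_casimir (fun a b => - dpi (delta_mx b a)) emb) = A.
  by rewrite blocksN blocks_casimir -/(gl_dual_entries dpi) -A'T.
have shift (M : 'M[R[i]]_(n * m)) : blocks (M - m%:R%:M) = blocks M - m%:R.
  by rewrite blocksD blocksN blocks_nat.
have plus := plus_blocks diff pi_irreducible rho_highest.
have minus := minus_blocks diff pi_irreducible rho_highest.
(* The shift s = 0 gives the plain powers needed on the right-hand sides; s = m will give the
   left-hand sides. *)
have plus0 p a b : \sum_i w_plus i ^+ p *: ((p_plus i a)^t* *m p_plus i b) = (A' ^+ p) a b.
  by have := plus 0 p a b; under eq_bigr do rewrite subr0; rewrite raddf0 subr0 blocksX cas_plus.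
have minus0 p a b : \sum_i w_minus i ^+ p *: ((p_minus i a)^t* *m p_minus i b) = (A ^+ p) a b.
  by have := minus 0 p a b; under eq_bigr do rewrite subr0; rewrite raddf0 subr0 blocksX cas_minus.
have [g cg] := choice (trace_pow_scalar diff pi_irreducible).
have [g' cg'] := choice (trace_dual_pow_scalar diff pi_irreducible).
split.
- refine (@conformal_identity R m n A (casimir dpi) g w_plus w_minus
    (fun i a b => (p_plus i a)^t* *m p_plus i b)
    (fun i a b => (p_minus i a)^t* *m p_minus i b) q k l
    (gl_entries_relations diff) (casimir_trace dpi) _ _ minus0) => [p|a b].
    by rewrite casimir_trace cg.
  by rewrite plus blocksX shift cas_plus AT.
(* The same identity for A' = - A^T, with the two tensor products exchanged. *)
- refine (@conformal_identity R m n A' (casimirc dpi) g' w_minus w_plus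
    (fun i a b => (p_minus i a)^t* *m p_minus i b)
    (fun i a b => (p_plus i a)^t* *m p_plus i b) q k l
    (gl_dual_entries_relations diff) (casimirc_trace dpi) _ _ plus0) => [p|a b].
    by rewrite casimirc_trace cg'.
  by rewrite minus blocksX shift cas_minus {1}A'T.
Qed.
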